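(* Let $n\ge 2$ and let $k$ be a field. Let $B(B_{n+1})$ be the braid group of type $\mathbf{B}_n$, presented as a monoid with generators $X_1\cup\{\Delta^{-1}\}$, where $X_1=\{r(\overline{\alpha}) : \alpha\in G\setminus\{1\}\}$ and $\Delta=r(s_{11}s_{21}\cdots s_{n-1,1}s_{n1}s_{n2}\cdots s_{nn})\in X_1$, and relations $\Delta^{\varepsilon}\Delta^{-\varepsilon}=1$ ($\varepsilon=\pm1$) and $r(\overline{\alpha})r(\overline{\beta})=r(\overline{\alpha\beta})$ ($\alpha\perp\beta$). Then the following set of relations is a Gröbner–Shirshov basis of $B(B_{n+1})$ with respect to the deg-lex ordering on $(X_1\cup\{\Delta^{-1}\})^*$: 1) $r(\overline{\alpha})r(\overline{\beta})=r(\overline{\alpha\beta})$, for $\alpha\perp\beta$; 2) $r(\overline{\alpha})r(\overline{\beta\gamma})=r(\overline{\alpha\beta})r(\overline{\gamma})$, for $\alpha\perp\beta\perp\gamma$; 3) $r(\overline{\alpha})\Delta^{\varepsilon}=\Delta^{\varepsilon}r(\overline{\alpha})$, for $\varepsilon=\pm1$; 4) $r(\overline{\alpha\beta})r(\overline{\gamma\mu})=\Delta\, r(\overline{\alpha})r(\overline{\mu})$, for $\alpha\perp\beta\perp\gamma\perp\mu$ with $r(\overline{\beta\gamma})=\Delta$ and ($\overline{\alpha}=1$ or $\overline{\mu}=1$); 5) $\Delta^{\varepsilon}\Delta^{-\varepsilon}=1$, for $\varepsilon=\pm1$. Here in 1)–3) $\alpha,\beta,\gamma$ range over $G\setminus\{1\}$,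 and in 4) $\alpha,\beta,\gamma,\mu$ range over $G$ with the convention $r(1)=1$ (empty word).
   Context: $G$ is the Coxeter group of type $\mathbf{B}_n$: generators $s_1,\dots,s_n$, relations $s_i^2=1$; $s_js_i=s_is_j$ ($j-1>i$); $s_{i+1}s_is_{i+1}=s_is_{i+1}s_i$ ($1\le i\le n-2$); $s_ns_{n-1}s_ns_{n-1}=s_{n-1}s_ns_{n-1}s_n$. Put $s_{ji}=s_js_{j-1}\cdots s_i$ for $j\ge i$ and $s_{j,j+1}=1$. Every $\alpha\in G$ equals a unique word $\overline{\alpha}=s_{1i_1}s_{2i_2}\cdots s_{n-1,i_{n-1}}s_{nj_1}\cdots s_{nj_t}$ with $1\le i_l\le l+1$, $1\le j_1<\cdots<j_t\le n$, $t\ge0$ (its normal form); $|\overline{\alpha}|$ is the number of letters $s_i$ in this word (the Coxeter length of $\alpha$). Write $\alpha\perp\beta$ if $|\overline{\alpha\beta}|=|\overline{\alpha}|+|\overline{\beta}|$; a chain such as $\alpha\perp\beta\perp\gamma$ means that consecutive elements are related by $\perp$. The symbol $r(\overline{\alpha})$ denotes a formal letter indexed by $\overline{\alpha}$. $B(B_{n+1})$ is the group with generators $\sigma_1,\dots,\sigma_n$ and relations $\sigma_j\sigma_i=\sigma_i\sigma_j$ ($j-1>i$), $\sigma_{i+1}\sigma_i\sigma_{i+1}=\sigma_i\sigma_{i+1}\sigma_i$ ($1\le i\le n-2$), $\sigma_n\sigma_{n-1}\sigma_n\sigma_{n-1}=\sigma_{n-1}\sigma_n\sigma_{n-1}\sigma_n$;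 the letter $r(\overline{\alpha})$ corresponds to the element obtained from the word $\overline{\alpha}$ by $s_i\mapsto\sigma_i$, and $\Delta^{-1}$ to the inverse of $\Delta$. Ordering: let $s_1<\cdots<s_n$. Order $X_1$ by $r(\overline{\alpha})<r(\overline{\beta})$ iff $|\overline{\alpha}|>|\overline{\beta}|$, or $|\overline{\alpha}|=|\overline{\beta}|$ and $\overline{\alpha}$ is lexicographically smaller than $\overline{\beta}$; the letter $\Delta^{-1}$ is smaller than every letter of $X_1$. The deg-lex ordering on words compares first the number of letters, then lexicographically. Gröbner–Shirshov bases (over an alphabet $Y$): for a monomial well-ordering on $Y^*$ and nonzero $f\in k\langle Y\rangle$ (free associative algebra with unit), $\bar f$ is the largest word occurring in $f$; $f$ is monic if the coefficient of $\bar f$ is 1. For monic $f,g$: if $w=\bar f b=a\bar g$ with $|\bar f|+|\bar g|>|w|$, then $(f,g)_w=fb-ag$ is an (intersection) composition; if $w=\bar f=a\bar g b$, then $(f,g)_w=f-agb$ is an (inclusion) composition. A composition is trivial modulo $(S,w)$ if it equals $\sum\alpha_i a_is_ib_i$ with $\alpha_i\in k$, $a_i,b_i\in Y^*$, $s_i\in S$ and $a_i\overline{s_i}b_i<w$. A set $S$ of monic polynomials is a Gröbner–Shirshov basis in $k\langle Y\rangle$ if all compositions of its elements are trivial. A relation $u=v$ between words is identified with the polynomial $u-v$ (multiplied by $-1$ if needed to be monic; identities $u=u$ are discarded). A set of relations $S$ is a Gröbner–Shirshov basis of a monoid $\langle Y\mid R\rangle$ if $S$ is a Gröbner–Shirshov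 basis in $k\langle Y\rangle$ and $S$ generates the same two-sided ideal as $R$ (so $S$ presents the same monoid). *)

(* Defs.v *)
From HB Require Import structures.
From mathcomp Require Import all_boot all_order all_algebra.
From mathcomp Require Import generic_quotient.
From mathcomp Require Import boolp classical_sets.
From mathcomp Require Import monalg.

Set Implicit Arguments.
Unset Strict Implicit.
Unset Printing Implicit Defensive.

(* Relations between words over T are pairs of words; [cong R] is the smallest
   congruence of the free monoid [seq T] containing R, so that [seq T] modulo
   [cong R] is the monoid presented by <T | R>. *)
Inductive cong (T : Type) (R : seq T -> seq T -> Prop) :
    seq T -> seq T -> Prop :=
| cong_refl u : cong R u u
| cong_sym u v : cong R u v -> cong R v u
| cong_trans u v w : cong R u v -> cong R v w -> cong R u w
| cong_rel a u v b : R u v -> cong R (a ++ u ++ b) (a ++ v ++ b).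

Lemma cong_catl T (R : seq T -> seq T -> Prop) a u v :
  cong R u v -> cong R (a ++ u) (a ++ v).
Proof.
elim=> [w|w1 w2 _|w1 w2 w3 _ h1 _ h2|b w1 w2 c r]; first exact: cong_refl.
- exact: cong_sym.
- exact: cong_trans h1 h2.
- by rewrite !(catA a); apply: cong_rel.
Qed.

Lemma cong_catr T (R : seq T -> seq T -> Prop) a u v :
  cong R u v -> cong R (u ++ a) (v ++ a).
Proof.
elim=> [w|w1 w2 _|w1 w2 w3 _ h1 _ h2|b w1 w2 c r]; first exact: cong_refl.
- exact: cong_sym.
- exact: cong_trans h1 h2.
- by rewrite -!catA; apply: cong_rel.
Qed.

Lemma cong_cat T (R : seq T -> seq T -> Prop) u u' v v' :
  cong R u u' -> cong R v v' -> cong R (u ++ v) (u' ++ v').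
Proof.
move=> hu hv; apply: (cong_trans (cong_catr v hu)); exact: cong_catl.
Qed.

(* The group presented by <T | R>, R relating positive words.  The letter
   (x, true) stands for x and (x, false) for its inverse. *)
Variant group_rel (T : Type) (R : seq T -> seq T -> Prop) :
    seq (T * bool) -> seq (T * bool) -> Prop :=
| group_rel_rel u v :
    R u v -> group_rel R [seq (x, true) | x <- u] [seq (x, true) | x <- v]
| group_rel_inv x e : group_rel R [:: (x, e); (x, ~~ e)] [::].

Section PresentedGroup.
Variables (T : choiceType) (R : seq T -> seq T -> Prop).

Let word := seq (T * bool).
Let pg_eqv (u v : word) : bool := `[< cong (group_rel R) u v >].

Fact pg_eqv_refl : reflexive pg_eqv.
Proof. by move=> u; apply/asboolP; exact: cong_refl. Qed.

Fact pg_eqv_sym : symmetric pg_eqv.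
Proof. by move=> u v; apply: asbool_equiv_eq; split; exact: cong_sym. Qed.

Fact pg_eqv_trans : transitive pg_eqv.
Proof.
move=> v u w /asboolP h1 /asboolP h2; apply/asboolP; exact: cong_trans h1 h2.
Qed.

Canonical pg_equiv : equiv_rel word :=
  EquivRel pg_eqv pg_eqv_refl pg_eqv_sym pg_eqv_trans.

Definition presented_group : Type := {eq_quot pg_equiv}%qT.
HB.instance Definition _ := Choice.on presented_group.
HB.instance Definition _ := EqQuotient.on presented_group.

Definition pg_class (u : word) : presented_group := (\pi_presented_group u)%qT.

Lemma pg_classP u v : pg_class u = pg_class v <-> cong (group_rel R) u v.
Proof.
split=> [/eqP|h]; first by rewrite /pg_class eqmodE /= => /asboolP.
by apply/eqP; rewrite /pg_class eqmodE; apply/asboolP.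
Qed.

Lemma pg_classK (g : presented_group) : pg_class (repr g) = g.
Proof. exact: reprK. Qed.

Definition word_inv (u : word) : word := rev [seq (x.1, ~~ x.2) | x <- u].

Definition pg_one : presented_group := pg_class [::].
Definition pg_mul (g h : presented_group) := pg_class (repr g ++ repr h).
Definition pg_inv (g : presented_group) := pg_class (word_inv (repr g)).

Lemma pg_mulE u v : pg_mul (pg_class u) (pg_class v) = pg_class (u ++ v).
Proof. by apply/pg_classP/cong_cat; apply/pg_classP; rewrite pg_classK. Qed.

Lemma word_mulV u : cong (group_rel R) (u ++ word_inv u) [::].
Proof.
elim: u => [|[x e] u ih] /=; first exact: cong_refl.
rewrite /word_inv /= rev_cons -/(word_inv u) -cats1 catA.
apply: cong_trans (cong_catl [:: (x, e)] (cong_catr [:: (x, ~~ e)] ih)) _.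
exact: (cong_rel [::] [::] (group_rel_inv R x e)).
Qed.

Lemma word_invK : involutive word_inv.
Proof.
move=> u; rewrite /word_inv map_rev revK -map_comp map_id_in//.
by case=> x e _ /=; rewrite negbK.
Qed.

Lemma word_mulVl u : cong (group_rel R) (word_inv u ++ u) [::].
Proof. by have := word_mulV (word_inv u); rewrite word_invK. Qed.

Fact pg_mulA : associative pg_mul.
Proof.
by move=> a b c; rewrite -[a]pg_classK -[b]pg_classK -[c]pg_classK !pg_mulE catA.
Qed.

Fact pg_mul1g : left_id pg_one pg_mul.
Proof. by move=> a; rewrite -[a]pg_classK pg_mulE. Qed.

Fact pg_mulg1 : right_id pg_one pg_mul.
Proof. by move=> a; rewrite -[a]pg_classK pg_mulE cats0. Qed.

Fact pg_mulVg : left_inverse pg_one pg_inv pg_mul.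
Proof.
move=> a; rewrite -[X in pg_mul _ X]pg_classK pg_mulE.
exact/pg_classP/word_mulVl.
Qed.

Fact pg_mulgV : right_inverse pg_one pg_inv pg_mul.
Proof.
move=> a; rewrite -[X in pg_mul X _]pg_classK pg_mulE.
exact/pg_classP/word_mulV.
Qed.

HB.instance Definition _ := isGroup.Build presented_group
  pg_mulA pg_mul1g pg_mulg1 pg_mulVg pg_mulgV.

Definition pg_gen (x : T) : presented_group := pg_class [:: (x, true)].

End PresentedGroup.

Section WordEvaluation.
Local Open Scope group_scope.

Definition word_prod (T : Type) (M : groupType) (f : T -> M) (w : seq T) : M :=
  \prod_(x <- w) f x.

Definition monoid_presentation (Y : Type) (R : seq Y -> seq Y -> Prop)
    (M : groupType) (f : Y -> M) : Prop :=
  (forall g : M, exists w : seq Y, word_prod f w = g) /\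
  (forall u v : seq Y, cong R u v <-> word_prod f u = word_prod f v).

End WordEvaluation.

Fixpoint lexlt (T : eqType) (lt : rel T) (u v : seq T) : bool :=
  match u, v with
  | x :: u', y :: v' => lt x y || (x == y) && lexlt lt u' v'
  | [::], _ :: _ => true
  | _, [::] => false
  end.

Definition deglex (T : eqType) (lt : rel T) (u v : seq T) : bool :=
  (size u < size v) || (size u == size v) && lexlt lt u v.

Section GroebnerShirshov.
Local Open Scope ring_scope.
Variables (k : fieldType) (Y : choiceType) (lt : rel (seq Y)).

Local Notation free_alg := {malg k[{fmonom Y}]}.

Definition mon (w : seq Y) : free_alg := << FMonom w >>.

Definition in_poly (w : seq Y) (f : free_alg) : Prop :=
  f@_(FMonom w) != 0.

Definition leading (f : free_alg) (w : seq Y) : Prop :=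
  in_poly w f /\ (forall v, in_poly v f -> v != w -> lt v w).

Definition gs_monic (f : free_alg) : Prop :=
  exists2 w, leading f w & f@_(FMonom w) = 1.

Definition trivial_mod (S : set free_alg) (w : seq Y)
    (h : free_alg) : Prop :=
  exists (m : nat) (c : 'I_m -> k) (a b : 'I_m -> seq Y)
         (s : 'I_m -> free_alg),
    [/\ forall i, S (s i),
        forall i, exists2 v, leading (s i) v & lt (a i ++ v ++ b i) w
      & h = \sum_(i < m) c i *: (mon (a i) * s i * mon (b i))].

Definition groebner_shirshov (S : set free_alg) : Prop :=
  [/\ forall f, S f -> gs_monic f,
      forall f g u v a b, S f -> S g -> leading f u -> leading g v ->
        u ++ b = a ++ v -> (size (u ++ b) < size u + size v)%N ->
        trivial_mod S (u ++ b) (f * mon b - mon a * g)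
    & forall f g u v a b, S f -> S g -> leading f u -> leading g v ->
        u = a ++ v ++ b ->
        trivial_mod S u (f - mon a * g * mon b)].

Definition ideal_of (S : set free_alg) :
    set free_alg :=
  [set h | exists (m : nat) (a b s : 'I_m -> free_alg),
     (forall i, S (s i)) /\ h = \sum_(i < m) a i * s i * b i]%classic.

(* The polynomials identified with the relations u = v of R: u - v or v - u,
   whichever is monic, the identities u = u being discarded. *)
Definition rel_polys (R : seq Y -> seq Y -> Prop) :
    set free_alg :=
  [set f | exists u v, [/\ R u v, u != v, gs_monic f
                         & f = mon u - mon v \/ f = mon v - mon u]]%classic.

Definition gs_basis_of_monoid (R S : seq Y -> seq Y -> Prop) : Prop :=
  groebner_shirshov (rel_polys S) /\
  ideal_of (rel_polys S) = ideal_of (rel_polys R).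

End GroebnerShirshov.

(* The generators s_1, ..., s_n are indexed by 'I_n, that is by 0, ..., n - 1;
   all subscripts below are shifted in the same way. *)
Section TypeB.
Variable n : nat.

Variant artinB_rel : seq 'I_n -> seq 'I_n -> Prop :=
| artinB_comm (i j : 'I_n) : i.+1 < j -> artinB_rel [:: j; i] [:: i; j]
| artinB_braid (i j : 'I_n) : j = i.+1 :> nat -> j.+1 < n ->
    artinB_rel [:: j; i; j] [:: i; j; i]
| artinB_four (i j : 'I_n) : j = i.+1 :> nat -> j.+1 = n ->
    artinB_rel [:: j; i; j; i] [:: i; j; i; j].

Variant coxeterB_rel : seq 'I_n -> seq 'I_n -> Prop :=
| coxeterB_sq (i : 'I_n) : coxeterB_rel [:: i; i] [::]
| coxeterB_artin u v : artinB_rel u v -> coxeterB_rel u v.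

Definition coxeterB : groupType := presented_group coxeterB_rel.
Definition braidB : groupType := presented_group artinB_rel.

Definition gen_s (i : 'I_n) : coxeterB := pg_gen coxeterB_rel i.
Definition sigma (i : 'I_n) : braidB := pg_gen artinB_rel i.

(* The word s_j s_{j-1} ... s_i; it is empty for i = j + 1. *)
Definition desc (j i : nat) : seq 'I_n :=
  rev [seq x : 'I_n <- enum 'I_n | i <= x <= j].

Definition normal_word (w : seq 'I_n) : Prop :=
  exists (i : nat -> nat) (js : seq 'I_n),
    [/\ forall l, l < n.-1 -> i l <= l.+1,
        sorted (fun x y : 'I_n => x < y) js
      & w = flatten [seq desc l (i l) | l <- iota 0 n.-1]
            ++ flatten [seq desc n.-1 j | j : 'I_n <- js]].

(* Each a is represented by exactly one normal word, so the default value
   [::] and the choice made by xget play no role. *)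
Definition nf (a : coxeterB) : seq 'I_n :=
  xget [::] [set w | normal_word w /\ word_prod gen_s w = a]%classic.

Definition len (a : coxeterB) : nat := size (nf a).

Definition perp (a b : coxeterB) : Prop := len (a * b)%g = len a + len b.

Definition X1 := {a : coxeterB | a != 1%g}.

(* The alphabet X_1 + {Delta^-1}; [None] is the letter Delta^-1. *)
Definition letter := option X1.

Definition X1_lt (x y : X1) : bool :=
  (len (val y) < len (val x)) ||
  (len (val x) == len (val y)) &&
    lexlt (fun i j : 'I_n => i < j) (nf (val x)) (nf (val y)).

Definition letter_lt (x y : letter) : bool :=
  match x, y with
  | None, Some _ => true
  | Some a, Some b => X1_lt a b
  | _, None => false
  end.

(* rr a is the one-letter word r(a) when a <> 1, and rr 1 is the empty word. *)
Definition rr (a : coxeterB) : seq letter :=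
  if insub a is Some x then [:: Some x] else [::].

Definition delta : coxeterB :=
  word_prod gen_s (flatten [seq desc l 0 | l <- iota 0 n.-1]
                   ++ flatten [seq desc n.-1 j | j <- iota 0 n]).

(* Delta true = Delta and Delta false = Delta^-1. *)
Definition Delta (e : bool) : seq letter := if e then rr delta else [:: None].

Definition letter_braid (x : letter) : braidB :=
  if x is Some a then word_prod sigma (nf (val a))
  else ((word_prod sigma (nf delta))^-1)%g.

Variant braidB_rel : seq letter -> seq letter -> Prop :=
| braidB_Delta e : braidB_rel (Delta e ++ Delta (~~ e)) [::]
| braidB_mul a b : a != 1%g -> b != 1%g -> perp a b ->
    braidB_rel (rr a ++ rr b) (rr (a * b)%g).

Variant gsB_rel : seq letter -> seq letter -> Prop :=
| gsB_1 a b : a != 1%g -> b != 1%g -> perp a b ->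
    gsB_rel (rr a ++ rr b) (rr (a * b)%g)
| gsB_2 a b c : a != 1%g -> b != 1%g -> c != 1%g -> perp a b -> perp b c ->
    gsB_rel (rr a ++ rr (b * c)%g) (rr (a * b)%g ++ rr c)
| gsB_3 a e : a != 1%g -> gsB_rel (rr a ++ Delta e) (Delta e ++ rr a)
| gsB_4 a b c m : perp a b -> perp b c -> perp c m ->
    rr (b * c)%g = Delta true -> a = 1%g \/ m = 1%g ->
    gsB_rel (rr (a * b)%g ++ rr (c * m)%g) (Delta true ++ rr a ++ rr m)
| gsB_5 e : gsB_rel (Delta e ++ Delta (~~ e)) [::].

End TypeB.

(* Main.v *)
Require Import Defs.
From mathcomp Require Import all_boot all_order all_algebra perm zify.
From mathcomp Require Import boolp classical_sets monalg.

(* The rewriting system 1)-5) moves every letter as far left as possible, so its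
   normal words are Delta^k r(a_1) ... r(a_m) with no nontrivial prefix of
   a_(i+1) absorbable into a_i. Termination is witnessed by a natural number, so
   the theorem reduces to: two congruent normal words are equal. Every
   composition is then a difference of two congruent words smaller than w, and
   rewriting both to their common normal word makes it trivial.

   Uniqueness of normal words is Garside's theory of the positive monoid. Prefix
   order on G has meets, because a common extension of x s_i and x s_j is also an
   extension of x w_ij, where w_ij is the longest element of <s_i, s_j>. Since
   a _|_ c means that c is a prefix of a^-1 Delta, each b has a longest prefix
   absorbable into a, and left insertion of letters into greedy sequences
   respects r(a) r(b) = r(ab). As Delta is central, Delta^-1 is handled by
   multiplying two congruent words by a common power of Delta.

   The facts on G come from its action on signed permutations of (n, ..., 1): the
   length is the number of positive roots sent to negative ones, descents are read
   off from adjacent coordinates, and Delta acts as -1. Matsumoto's theorem,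
   which follows from the fact that w_ij is a prefix of every element with left
   descents s_i and s_j, gives both the faithfulness of the action and the map
   from the monoid to the braid group. *)

Set Implicit Arguments.
Unset Strict Implicit.
Unset Printing Implicit Defensive.

Import GRing.Theory.

(** * Signed permutations and inversions *)

(** A simple reflection permutes the positive roots other than its own simple root: in the
    applications [h] is this permutation, [a] the simple root, and [P], [Q] the inversions before
    and after. *)
Lemma card_involution_flip (T : finType) (P Q : pred T) (a : T) (h : T -> T) :
  involutive h -> h a = a -> (forall p, p != a -> Q p = P (h p)) ->
  ~~ Q a -> P a -> #|Q|.+1 = #|P|.
Proof.
move=> hK ha QP Qa Pa.
rewrite (cardD1 a P) [a \in P]Pa (cardD1 a Q) [a \in Q](negbTE Qa) add0n add1n.
congr _.+1; rewrite -[RHS](card_imset _ (can_inj hK)).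
apply: eq_card => p; rewrite !inE; apply/andP/imsetP => [[pa Qp]|[q]].
  exists (h p); last by rewrite hK.
  rewrite !inE -[X in _ != X]ha (inj_eq (can_inj hK)) pa /=.
  by rewrite -[in X in is_true X]topredE /= -QP.
rewrite !inE => /andP[qa Pq] ->.
have pa : h q != a by rewrite -[X in _ != X]ha (inj_eq (can_inj hK)).
by split=> //; rewrite -topredE /= QP // hK.
Qed.

Ltac index_cases :=
  match goal with |- context [(?a : nat) == ?b] =>
    case: (a =P b) => ?; try (exfalso; lia) end.

Section SignedPermutations.
Variable n : nat.
Implicit Types (i j : nat) (x y : nat -> int) (u v w p q : seq 'I_n).

Definition act i x : nat -> int :=
  if i.+1 < n then
    fun j => if j == i then x i.+1 else if j == i.+1 then x i else x j
  else fun j => if j == i then (- x j)%R else x j.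

Definition wact w x : nat -> int := foldr (fun i : 'I_n => act i) x w.

(** A point inside the dominant chamber; truncated subtraction makes it vanish from index [n] on, as
    [regular] demands. *)
Definition rho j : int := Posz (n - j).

(* The positive roots of B_n, as linear forms: e_i - e_j for i < j, and
   e_i + e_j for j <= i (twice a short pos_root when i = j). *)
Definition pos_root i j x : int := if i < j then (x i - x j)%R else (x i + x j)%R.

Definition ninv x : nat := #|[pred p : 'I_n * 'I_n | (pos_root p.1 p.2 x < 0)%R]|.

(** Negativity at [x] of the [i]-th simple root, which is [e_i - e_(i+1)] or, at the end, [e_i]. *)
Definition descent i x : bool :=
  if i.+1 < n then (x i < x i.+1)%R else (x i < 0)%R.

(** These are the signed permutations of (n, ..., 1), continued by 0: taking [i = j] in the first
    condition excludes zero entries, and the first two conditions make the absolute values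
    distinct. *)
Definition regular x : Prop :=
  [/\ forall i j, i < n -> j < n -> (x i + x j)%R != 0%R,
      forall i j, i < n -> j < n -> x i = x j -> i = j,
      forall j, j < n -> (`|x j| <= Posz n)%R
    & forall j, n <= j -> x j = 0%R].

Lemma actK i : involutive (act i).
Proof.
move=> x; apply: funext => j; rewrite /act.
case: (ltnP i.+1 n) => hi.
  by do ?case: eqP => ?; subst; lia.
by do ?case: eqP => ?; subst; lia.
Qed.

Lemma wact_cat u v x : wact (u ++ v) x = wact u (wact v x).
Proof. exact: foldr_cat. Qed.

Lemma wact_rev w x : wact (rev w) (wact w x) = x.
Proof.
elim: w x => [|i w IH] x //=.
by rewrite rev_cons -cats1 wact_cat /= actK IH.
Qed.

Lemma wact_revr w x : wact w (wact (rev w) x) = x.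
Proof. by rewrite -{1}[w]revK wact_rev. Qed.

Lemma regular_rho : regular rho.
Proof. by split=> [i j hi hj|i j hi hj|j hj|j hj]; rewrite /rho; lia. Qed.

Lemma regular_act i x : i < n -> regular x -> regular (act i x).
Proof.
move=> hi [h1 h2 h3 h4]; rewrite /act; case: (ltnP i.+1 n) => hi1; last first.
  split=> [a b ha hb|a b ha hb|j hj|j hj].
  - by have := h1 _ _ ha hb; have := h2 _ _ ha hb; case: (a =P i); case: (b =P i); lia.
  - by have := h1 _ _ ha hb; have := h2 _ _ ha hb; case: (a =P i); case: (b =P i); lia.
  - by have := h3 _ hj; case: (j =P i); lia.
  - by have := h4 _ hj; case: (j =P i); lia.
pose t c := if c == i then i.+1 else if c == i.+1 then i else c.
have tn c : c < n -> t c < n by rewrite /t; do ?case: ifP; lia.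
have tinj a b : t a = t b -> a = b by rewrite /t; do ?case: ifP; lia.
have aE c : (if c == i then x i.+1 else if c == i.+1 then x i else x c) = x (t c).
  by rewrite /t; do ?case: eqP.
split=> [a b ha hb|a b ha hb|j hj|j hj]; rewrite !aE.
- by apply: h1; apply: tn.
- by move=> h; apply/tinj/h2 => //; apply: tn.
- exact/h3/tn.
- by have := h4 j hj; rewrite /t; do ?case: ifP; lia.
Qed.

Lemma regular_pos_root i j x : regular x -> i < n -> j < n -> pos_root i j x != 0%R.
Proof.
case=> h1 h2 _ _ hi hj; have := h1 _ _ hi hj; have := h2 _ _ hi hj.
by rewrite /pos_root; case: ifP; lia.
Qed.

Lemma regular_wact w x : regular x -> regular (wact w x).
Proof. by move=> hx; elim: w => //= i w; apply: regular_act. Qed.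

Lemma descent_act i x : i < n -> regular x ->
  descent i (act i x) = ~~ descent i x.
Proof.
move=> hi [h1 h2 _ _]; rewrite /descent /act; case: (ltnP i.+1 n) => hi1; rewrite ?eqxx.
  by have := h2 i i.+1 hi hi1; rewrite (gtn_eqF (ltnSn i)); lia.
by have := h1 i i hi hi; lia.
Qed.

Lemma ninv_act_descent i x : i < n -> regular x -> descent i x ->
  (ninv (act i x)).+1 = ninv x.
Proof.
move=> hi hx hd; have hd' := descent_act hi hx; rewrite hd /= in hd'.
move: hd hd'; rewrite /ninv /descent; case: (ltnP i.+1 n) => hi1 hd hd'.
  pose i0 : 'I_n := Ordinal hi; pose i1 : 'I_n := Ordinal hi1.
  pose t := tperm i0 i1.
  (* The pair (i+1, i) encodes the root [e_i + e_(i+1)], which the transposition fixes; exchanging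
     its indices would turn it into the simple root. *)
  pose h (p : 'I_n * 'I_n) :=
    if (p == (i0, i1)) || (p == (i1, i0)) then p else (t p.1, t p.2).
  have tv (c : 'I_n) : t c = (if c == i :> nat then i.+1
      else if c == i.+1 :> nat then i else c) :> nat.
    rewrite /t; case: tpermP => [->|->|]; rewrite /= ?eqxx ?(gtn_eqF (ltnSn i)) // => /eqP.
    rewrite -val_eqE /= => /negbTE -> /eqP; rewrite -val_eqE /= => /negbTE -> //.
  have hE (p : 'I_n * 'I_n) : h p =
      if (p.1 == i :> nat) && (p.2 == i.+1 :> nat)
         || (p.1 == i.+1 :> nat) && (p.2 == i :> nat) then p else (t p.1, t p.2).
    by case: p.
  apply: (@card_involution_flip _ _ _ (i0, i1) h).
  - move=> p; rewrite (hE p); case: ifP => hp; first by rewrite hE hp.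
    rewrite hE /= !tv; case: ifP => hp'; last by rewrite !tpermK; case: p {hp hp'}.
    by move: hp hp'; case: p => a b /=; do ?case: ifP; lia.
  - by rewrite /h eqxx.
  - case=> a b; rewrite xpair_eqE -!val_eqE /= => pa; rewrite hE /=.
    have aE (c : 'I_n) : act i x c = x (t c).
      by rewrite tv /act hi1; do 2?case: eqP.
    congr (_ < 0)%R; move: pa; case: ifP => hp hq /=; rewrite /pos_root !aE; last first.
      suff -> : (t a < t b) = (a < b) by [].
      by move: hp hq; rewrite !tv; do ?case: ifP; lia.
    have [a1 b0] : a = i1 /\ b = i0.
      by split; apply: val_inj => /=; lia.
    rewrite a1 b0 /= ltnNge leqnSn /= /t tpermL tpermR /=; exact: addrC.
  - by move: hd'; rewrite /= /pos_root ltnSn; lia.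
  - by rewrite /= /pos_root ltnSn; lia.
pose i0 : 'I_n := Ordinal hi.
(* Changing the sign of the last coordinate exchanges [e_a - e_i] and [e_a + e_i], encoded by the
   pairs (a, i) and (i, a). *)
pose h (p : 'I_n * 'I_n) := if (p.1 == i0) || (p.2 == i0) then (p.2, p.1) else p.
apply: (@card_involution_flip _ _ _ (i0, i0) h).
- case=> a b; rewrite /h /=; case: (boolP ((a == i0) || (b == i0))) => hp /=.
    by rewrite orbC hp.
  by rewrite (negbTE hp).
- by rewrite /h eqxx.
- case=> a b; rewrite xpair_eqE -!val_eqE /= => pa; rewrite /h -!val_eqE /=.
  have hn : (i.+1 < n) = false by lia.
  have := ltn_ord a; have := ltn_ord b => hb ha; rewrite /pos_root /act hn.
  case: (nat_of_ord a =P i) pa => [ai|ai] pa; case: (nat_of_ord b =P i) pa => [bi|bi] pa /=.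
  - by lia.
  - by case: (ltnP a b); case: (ltnP b a); lia.
  - by case: (ltnP a b); case: (ltnP b a); lia.
  - by case: (ltnP a b); lia.
- by move: hd'; rewrite /= /pos_root ltnn; lia.
- by rewrite /= /pos_root ltnn; lia.
Qed.

Lemma ninv_act_ascent i x : i < n -> regular x -> ~~ descent i x ->
  ninv (act i x) = (ninv x).+1.
Proof.
move=> hi hx hd; have hx' := regular_act hi hx.
by rewrite -(ninv_act_descent hi hx') ?actK // descent_act.
Qed.

Lemma ninv_rho : ninv rho = 0.
Proof.
apply: eq_card0 => -[a b]; rewrite !inE /= /pos_root /rho; case: ifP; lia.
Qed.

Lemma ninv_wact_le w x : regular x -> ninv (wact w x) <= size w + ninv x.
Proof.
move=> hx; elim: w => [|i w IH] //=; have hw := regular_wact w hx.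
have [hd|hd] := boolP (descent i (wact w x)).
  by have := ninv_act_descent (ltn_ord i) hw hd; lia.
by rewrite ninv_act_ascent // addSn ltnS.
Qed.

(** Without descents the entries decrease strictly and end with a positive one, so [x j >= n - j] by
    induction from the end; the bound [n] on the first entry gives [x j <= n - j] by induction from
    the start. *)
Lemma no_descent_rho x : regular x -> (forall i : 'I_n, ~~ descent i x) -> x = rho.
Proof.
move=> [h1 h1' h2 h3] nd; apply: funext => j; rewrite /rho.
have [hj|hj] := leqP n j; first by rewrite h3 //; lia.
have up : forall d j, j + d.+1 = n -> (x j >= Posz d.+1)%R.
  elim=> [|d IH] i hi.
    have hi' : i < n by lia.
    have := nd (Ordinal hi'); rewrite /descent /= (_ : (i.+1 < n) = false); last lia.
    by have := h1 i i hi' hi'; lia.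
  have hi' : i < n by lia.
  have hi1 : i.+1 < n by lia.
  have := nd (Ordinal hi'); rewrite /descent /= hi1.
  have := h1' i i.+1 hi' hi1; have := IH i.+1; lia.
have dn : forall i, i < n -> (x i <= Posz (n - i))%R.
  elim=> [|i IH] hi; first by have := h2 0 hi; lia.
  have hi' : i < n by lia.
  have := nd (Ordinal hi'); rewrite /descent /= hi.
  have := h1' i i.+1 hi' hi; have := IH hi'; lia.
have := dn j hj; have := up (n - j).-1 j; lia.
Qed.

Lemma ninv0_rho x : regular x -> ninv x = 0 -> x = rho.
Proof.
move=> hx h0; apply: no_descent_rho => // i; apply/negP => hd.
by have := ninv_act_descent (ltn_ord i) hx hd; rewrite h0.
Qed.

(** The inversion number stands in for the Coxeter length; [reduced_len] identifies the two. *)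
Definition reduced w : Prop := ninv (wact w rho) = size w.

Lemma reduced_tail (i : 'I_n) w : reduced (i :: w) -> reduced w.
Proof.
rewrite /reduced /= => h; have := ninv_wact_le w regular_rho; rewrite ninv_rho.
have := @ninv_wact_le [:: i] _ (regular_wact w regular_rho); rewrite /= h; lia.
Qed.

Lemma reduced_descent (i : 'I_n) w : reduced (i :: w) -> descent i (wact (i :: w) rho).
Proof.
move=> h; have h' := reduced_tail h; move: h h'; rewrite /reduced /= => h h'.
have hw := regular_wact w regular_rho.
rewrite descent_act //; apply/negP => hd.
by have := ninv_act_descent (ltn_ord i) hw hd; rewrite h h'; lia.
Qed.

Lemma reduced_word_exists x : regular x -> exists2 w, reduced w & wact w rho = x.
Proof.
elim: {x}(ninv x) {-2}x (erefl (ninv x)) => [|m IH] x hm hx.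
  by exists [::]; [exact: ninv_rho | rewrite (ninv0_rho hx)].
have [[i hd]|nd] := pselect (exists i : 'I_n, descent i x).
  have hE := ninv_act_descent (ltn_ord i) hx hd.
  have [||w rw hw] := IH (act i x); [lia|exact: regular_act|].
  have hxi : wact (i :: w) rho = x by rewrite /= hw actK.
  by exists (i :: w) => //; rewrite /reduced hxi /= hm -rw hw; congr _.+1; lia.
have := no_descent_rho hx => hr; move: hm; rewrite hr ?ninv_rho // => i.
by apply/negP => hd; apply: nd; exists i.
Qed.

Lemma wact_artin u v x : artinB_rel u v -> wact u x = wact v x.
Proof.
case=> [i j hij|i j hij hj|i j hij hj] /=; apply: funext => c.
- have hi : i.+1 < n by have := ltn_ord j; lia.
  rewrite /act hi; case: (ltnP j.+1 n) => hj.
    by repeat index_cases; first [done|congr x; lia].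
  by repeat index_cases; first [done|congr x; lia|congr (- x _)%R; lia].
- rewrite /act hj (_ : i.+1 < n); last lia.
  by rewrite hij; repeat index_cases; first [done|congr x; lia].
- rewrite /act hj ltnn hij (_ : i.+1 < n); last lia.
  by repeat index_cases; first [done|congr x; lia|congr (- x _)%R; lia].
Qed.

Lemma wact_coxeter u v x : coxeterB_rel u v -> wact u x = wact v x.
Proof. by case=> [i|{}u {}v h]; [rewrite /= actK|exact: wact_artin]. Qed.


End SignedPermutations.

(** * Matsumoto's theorem *)

Section Matsumoto.
Variable n : nat.
Implicit Types (i j : 'I_n) (x y : nat -> int) (u v w p q : seq 'I_n).

Fixpoint descending w x : bool :=
  if w is i :: w' then descent n i (wact w' x) && descending w' x else true.

Lemma ninv_descending w x : regular n x -> descending w x ->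
  ninv n (wact w x) + size w = ninv n x.
Proof.
move=> hx; elim: w => [|i w IH] /=; first by rewrite addn0.
move=> /andP[hi /IH <-].
by rewrite -(ninv_act_descent (ltn_ord i) (regular_wact w hx) hi) addSnnS.
Qed.

(** When two simple roots are negative at [x], so are all positive roots of the subsystem they span,
    and the reverse of either side of the relation makes these positive one at a time. *)
Lemma artin_descending p q x : artinB_rel p q ->
  (forall i, i \in p -> descent n i x) ->
  descending (rev p) x && descending (rev q) x.
Proof.
case=> [i j hij|i j hij hj|i j hij hj] h;
  have := h i ltac:(by rewrite !inE eqxx ?orbT);
  have {h} := h j ltac:(by rewrite !inE eqxx ?orbT); rewrite /= /descent /act.
- have hi : i.+1 < n by have := ltn_ord j; lia.
  by rewrite hi; case: (ltnP j.+1 n) => hj hd1 hd2; rewrite !andbT ?hi ?hj;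
    apply/andP; split; repeat (apply/andP; split); rewrite //; repeat index_cases; lia.
- rewrite hj hij (_ : i.+1 < n); last lia.
  move=> hd1 hd2; apply/andP; split; repeat (apply/andP; split); rewrite //;
    repeat index_cases; lia.
- rewrite hj ltnn hij (_ : i.+1 < n); last lia.
  move=> hd1 hd2; apply/andP; split; repeat (apply/andP; split); rewrite //;
    repeat index_cases; lia.
Qed.

Lemma artin_letters i j : i != j -> exists p q, 
  [/\ artinB_rel (i :: p) (j :: q) \/ artinB_rel (j :: q) (i :: p)
    & forall l, (l \in i :: p) || (l \in j :: q) -> (l == i) || (l == j)].
Proof.
wlog lij : i j / i < j => [th ij|].
  have [/(th i j)|/(th j i) h|/val_inj e] := ltngtP i j; first exact.
    move: ij; rewrite eq_sym => /h [p [q [hr hl]]]; exists q, p; split; first by case: hr; auto.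
    by move=> l; rewrite orbC => /hl; rewrite orbC.
  by rewrite e eqxx in ij.
have [hij _|hij _] := ltnP i.+1 j.
  exists [:: j], [:: i]; split; first by right; apply: artinB_comm.
  by move=> l; rewrite !inE; do 2?case: eqP.
have e : j = i.+1 :> nat by lia.
have [hj|hj] := ltnP j.+1 n.
  exists [:: j; i], [:: i; j]; split; first by right; apply: artinB_braid.
  by move=> l; rewrite !inE; do 2?case: eqP.
exists [:: j; i; j], [:: i; j; i]; split.
  by right; apply: artinB_four => //; have := ltn_ord j; lia.
by move=> l; rewrite !inE; do 2?case: eqP.
Qed.

(** [i :: p] and [j :: q] are the two sides of the relation between the generators, that is, two
    words for the longest element of the subgroup they generate. It splits off, lengths adding, from
    every element with both descents. *)
Lemma common_descents i j : i != j -> exists p q,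
  [/\ cong (@artinB_rel n) (i :: p) (j :: q),
      forall x, wact (i :: p) x = wact (j :: q) x
    & forall x, regular n x -> descent n i x -> descent n j x ->
        ninv n (wact (rev (i :: p)) x) + size (i :: p) = ninv n x /\
        ninv n (wact (rev (j :: q)) x) + size (j :: q) = ninv n x].
Proof.
move=> /artin_letters [p [q [hr hl]]]; exists p, q; split.
- by case: hr => /(cong_rel [::] [::]); rewrite !cats0 // => /cong_sym.
- by case: hr => h x; [apply: wact_artin|symmetry; apply: wact_artin].
move=> x hx hi hj.
have hd l : (l \in i :: p) || (l \in j :: q) -> descent n l x.
  by move=> /hl /orP[] /eqP->.
have /andP[h1 h2] : descending (rev (i :: p)) x && descending (rev (j :: q)) x.
  case: hr => hr; first by apply: (artin_descending hr) => l hlp; apply: hd; rewrite hlp.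
  by rewrite andbC; apply: (artin_descending hr) => l hlp; apply: hd; rewrite hlp orbT.
by rewrite -[X in _ + X]size_rev -[X in _ /\ _ + X = _]size_rev !ninv_descending.
Qed.

(** Induction on the length. Equal first letters are cancelled. Otherwise [u] and [v] are compared
    through [i :: p ++ z] and [j :: q ++ z], which are congruent by [common_descents] and share
    their first letters with [u] and [v]. *)
Lemma matsumoto u v : reduced u -> reduced v ->
  wact u (rho n) = wact v (rho n) -> cong (@artinB_rel n) u v.
Proof.
elim: {u}(size u) {-2}u v (erefl (size u)) => [|m IH] u v hm ru rv huv.
  have hv : size v = 0 by rewrite -rv -huv ru.
  by move: hm hv => /size0nil-> /size0nil->; apply: cong_refl.
have hv : size v = m.+1 by rewrite -rv -huv ru.
case: u hm ru huv => // i u [hu] ru huv; case: v hv rv huv => // j v [hv] rv huv.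
have [ij|ij] := eqVneq i j.
  rewrite -ij in huv *; apply: (cong_catl [:: i]); apply: IH => //.
  - exact: reduced_tail ru.
  - exact: reduced_tail rv.
  - exact: (can_inj (actK _ _)) huv.
have [p [q [hpq wpq red]]] := common_descents ij.
set x := wact (i :: u) (rho n) in huv.
have hx : regular n x by apply/regular_wact/regular_rho.
have di : descent n i x by apply: reduced_descent.
have dj : descent n j x by rewrite huv; apply: reduced_descent.
have [nx nx'] := red x hx di dj.
(* [z] is a reduced word for what remains of [x] once the longest element of the rank 2 subgroup is
   removed. *)
have [z rz hz] := reduced_word_exists (regular_wact (rev (i :: p)) hx).
have xp : wact (i :: p ++ z) (rho n) = x.
  by rewrite -cat_cons wact_cat hz wact_revr.
have xq : wact (j :: q ++ z) (rho n) = x.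
  by rewrite -cat_cons wact_cat -wpq -wact_cat xp.
have sp : reduced (i :: p ++ z).
  by rewrite /reduced xp -nx -cat_cons size_cat -rz hz addnC.
have spq : size (i :: p) = size (j :: q).
  move: nx nx'; suff -> : wact (rev (i :: p)) x = wact (rev (j :: q)) x by lia.
  by rewrite -[X in wact (rev (i :: p)) X](wact_revr (j :: q)) -wpq wact_rev.
have sq : reduced (j :: q ++ z).
  by rewrite /reduced xq -xp sp -!cat_cons !size_cat spq.
have inj (k : 'I_n) (a b : seq 'I_n) : wact (k :: a) (rho n) = wact (k :: b) (rho n) ->
    wact a (rho n) = wact b (rho n) by apply: (can_inj (actK _ _)).
apply: (@cong_trans _ _ _ (i :: p ++ z)).
  apply: (cong_catl [:: i]); apply: IH => //.
  - exact: reduced_tail ru.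
  - exact: reduced_tail sp.
  - by apply: (inj i); rewrite xp.
apply: (@cong_trans _ _ _ (j :: q ++ z)).
  by rewrite -!cat_cons; apply: cong_catr.
apply: cong_sym; apply: (cong_catl [:: j]); apply: IH => //.
- exact: reduced_tail rv.
- exact: reduced_tail sq.
- by apply: (inj j); rewrite xq.
Qed.

(** If prefixing [i] lowers the inversion number, Matsumoto's theorem rewrites [u] so that it begins
    with [i], and [coxeterB_sq] cancels the two letters. *)
Lemma coxeter_reduce w : exists2 u, reduced u & cong (@coxeterB_rel n) w u.
Proof.
elim: w => [|i w [u ru hu]]; first by exists [::]; [exact: ninv_rho|exact: cong_refl].
have h := cong_catl [:: i] hu.
have hx := regular_wact u (regular_rho n).
have [hd|hd] := boolP (descent n i (wact u (rho n))); last first.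
  by exists (i :: u) => //; rewrite /reduced /= ninv_act_ascent // ru.
have [z rz hz] := reduced_word_exists (regular_act (ltn_ord i) hx).
exists z => //; apply: cong_trans h _.
have riz : reduced (i :: z).
  by rewrite /reduced /= hz actK -(ninv_act_descent (ltn_ord i) hx hd) -hz rz.
have huz : cong (@artinB_rel n) u (i :: z).
  by apply: matsumoto => //=; rewrite hz actK.
have {}huz : cong (@coxeterB_rel n) u (i :: z).
  elim: huz => [a|a b _ |a b c _ h1 _ h2|a b c d hr].
  - exact: cong_refl.
  - exact: cong_sym.
  - exact: cong_trans h1 h2.
  - by apply: cong_rel; right.
apply: cong_trans (cong_catl [:: i] huz) _.
exact: (cong_rel [::] z (coxeterB_sq i)).
Qed.

End Matsumoto.

(** * Normal words *)

Section NormalWords.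
Variable n : nat.
Implicit Types (x y z : nat -> int) (w : seq 'I_n).

Lemma map_val_desc l i : l < n ->
  [seq val j | j <- @desc n l i] = rev (iota i (l.+1 - i)).
Proof.
move=> hl; rewrite /desc map_rev; congr rev.
have -> : [seq val j | j <- [seq j : 'I_n <- enum 'I_n | i <= j <= l]]
        = [seq j <- iota 0 n | i <= j <= l].
  by rewrite -val_enum_ord filter_map.
apply: (irr_sorted_eq ltn_trans ltnn).
- by apply: sorted_filter; [exact: ltn_trans|exact: iota_ltn_sorted].
- exact: iota_ltn_sorted.
- move=> j; rewrite mem_filter !mem_iota; lia.
Qed.

Lemma wact_val w x : wact w x = foldr (@act n) x [seq val i | i <- w].
Proof. by rewrite foldr_map. Qed.

Lemma regular_foldr_act (s : seq nat) x :
  {in s, forall i, i < n} -> regular n x -> regular n (foldr (@act n) x s).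
Proof.
move=> hs hx; elim: s hs => //= i s IH hs; apply: regular_act.
  by apply: hs; rewrite inE eqxx.
by apply: IH => j hj; apply: hs; rewrite inE hj orbT.
Qed.

Lemma act_cycle x i k : i + k < n ->
  foldr (@act n) x (rev (iota i k)) =
  fun j => if j < i then x j else if j < i + k then x j.+1
           else if j == i + k then x i else x j.
Proof.
elim: k => [|k IH] hk; apply: funext => j.
  by rewrite /= addn0; case: (ltnP j i) => // _; case: (j =P i) => // ->.
rewrite -addn1 iotaD rev_cat /= IH ?addn1; last lia.
rewrite /act; have -> : (i + k).+1 < n by lia.
case: (j =P i + k) => [->|h1]; last case: (j =P (i + k).+1) => [->|h2].
- have -> : (i + k < i) = false by lia.
  have -> : ((i + k).+1 < i) = false by lia.
  have -> : ((i + k).+1 < i + k) = false by lia.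
  have -> : ((i + k).+1 == i + k) = false by lia.
  by have -> : (i + k < i + k.+1) by lia.
- have -> : (i + k < i) = false by lia.
  have -> : ((i + k).+1 < i) = false by lia.
  have -> : ((i + k).+1 < i + k.+1) = false by lia.
  by rewrite ltnn eqxx addnS eqxx.
- case: ifP => // h3.
  have -> : (j < i + k.+1) = (j < i + k) by lia.
  by have -> : (j == i + k.+1) = false by lia.
Qed.

(** The entry [x i] travels to the right past smaller entries, so every swap is an ascent. *)
Lemma ninv_act_cycle x i k : i + k < n -> regular n x ->
  (forall m, i < m <= i + k -> (x m < x i)%R) ->
  ninv n (foldr (@act n) x (rev (iota i k))) = ninv n x + k.
Proof.
move=> + hx; elim: k => [|k IH] hk h; first by rewrite addn0.
have hik : i + k < n by lia.
rewrite -addn1 iotaD rev_cat /= ninv_act_ascent ?IH ?addn1 ?addnS //.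
- by move=> m hm; apply: h; lia.
- by apply: regular_foldr_act => // j; rewrite mem_rev mem_iota; lia.
- rewrite act_cycle // /descent addnS in hk *; rewrite hk.
  have -> : (i + k < i) = false by lia.
  have -> : ((i + k).+1 < i) = false by lia.
  have -> : ((i + k).+1 < i + k) = false by lia.
  have -> : ((i + k).+1 == i + k) = false by lia.
  by rewrite ltnn eqxx; have := h (i + k).+1; lia.
Qed.

Definition decreasing_upto m x : Prop :=
  forall i j, i < j -> j <= m -> (x j < x i)%R.

Definition desc_product m (i : nat -> nat) : seq 'I_n :=
  flatten [seq desc n l (i l) | l <- iota 0 m].

Lemma desc_productS m i :
  desc_product m.+1 i = desc_product m i ++ desc n m (i m).
Proof. by rewrite /desc_product -addn1 iotaD map_cat flatten_cat /= cats0. Qed.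

(** The factors undo an insertion sort. The rightmost one acts first: it carries an entry of a
    decreasing run to the end of the run, past smaller entries, and leaves a shorter decreasing run
    to the other factors. *)
Lemma ninv_desc_product m i x : m < n -> (forall l, l < m -> i l <= l.+1) ->
  regular n x -> decreasing_upto m x ->
  ninv n (wact (desc_product m i) x) = ninv n x + size (desc_product m i).
Proof.
elim: m x => [|m IH] x hm hi hx dx; first by rewrite addn0.
rewrite desc_productS wact_cat size_cat.
have him := hi m (ltnSn m).
have e : wact (desc n m (i m)) x = foldr (@act n) x (rev (iota (i m) (m.+1 - i m))).
  by rewrite wact_val map_val_desc //; lia.
have sz : size (desc n m (i m)) = m.+1 - i m.
  by rewrite -(size_map val) map_val_desc ?size_rev ?size_iota //; lia.
have hsum : i m + (m.+1 - i m) = m.+1 by lia.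
rewrite IH ?sz; first last.
- rewrite e act_cycle ?hsum // => a b hab hb.
  have -> : (a < m.+1) by lia.
  have -> : (b < m.+1) by lia.
  by do 2?case: ifP => ?; apply: dx; lia.
- exact: regular_wact.
- by move=> l hl; apply: hi; lia.
- by lia.
rewrite e ninv_act_cycle ?hsum //; first by lia.
by move=> l hl; apply: dx; lia.
Qed.

Definition flip_product (js : seq 'I_n) : seq 'I_n :=
  flatten [seq desc n n.-1 j | j : 'I_n <- js].

Lemma wact_desc_last j x : j < n ->
  wact (desc n n.-1 j) x =
  fun l => if l < j then x l else if l < n.-1 then x l.+1
           else if l == n.-1 then (- x j)%R else x l.
Proof.
move=> hj; rewrite wact_val map_val_desc; last lia.
have -> : n.-1.+1 - j = (n.-1 - j) + 1 by lia.
rewrite iotaD rev_cat /= act_cycle; last lia.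
have -> : j + (n.-1 - j) = n.-1 by lia.
apply: funext => l; rewrite /act.
have -> : (n.-1.+1 < n) = false by lia.
case: (l =P n.-1) => [->|//].
have -> : (n.-1 < j) = false by lia.
by rewrite ltnn.
Qed.

Lemma ninv_desc_last j x : j < n -> regular n x -> (0 < x j)%R ->
  decreasing_upto n.-1 x ->
  ninv n (wact (desc n n.-1 j) x) = ninv n x + size (desc n n.-1 j).
Proof.
move=> hj hx xj dx.
have -> : size (desc n n.-1 j) = (n.-1 - j).+1.
  by rewrite -(size_map val) map_val_desc ?size_rev ?size_iota; lia.
rewrite wact_val map_val_desc; last lia.
have -> : n.-1.+1 - j = (n.-1 - j) + 1 by lia.
have e : j + (n.-1 - j) = n.-1 by lia.
rewrite iotaD rev_cat /= e ninv_act_ascent ?ninv_act_cycle ?addnS ?e //; try lia.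
- by move=> m hm; apply: dx; lia.
- by apply: regular_foldr_act => // i; rewrite mem_rev mem_iota; lia.
- rewrite act_cycle e /descent; last lia.
  have -> : (n.-1.+1 < n) = false by lia.
  have -> : (n.-1 < j) = false by lia.
  by rewrite ltnn eqxx; lia.
Qed.

Lemma flip_productP js b : b <= n ->
  sorted (fun x y : 'I_n => x < y) js -> {in js, forall j : 'I_n, b <= j} ->
  let x := wact (flip_product js) (rho n) in
  [/\ decreasing_upto n.-1 x, forall m, m < b -> x m = rho n m,
      forall m, b <= m -> m < n -> (`|x m| <= Posz (n - b))%R
    & ninv n x = size (flip_product js)].
Proof.
elim: js b => [|j js IH] b hb srt hjs /=.
  split; last exact: ninv_rho.
  - by move=> i k; rewrite /rho; lia.
  - by [].
  - by move=> m h1 h2; rewrite /rho; lia.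
have hj := ltn_ord j.
have bj : b <= j by apply: hjs; rewrite inE eqxx.
have tr : transitive (fun x y : 'I_n => x < y) by move=> ? ? ?; apply: ltn_trans.
have [|||dx xr xb nx] := IH j.+1.
- by [].
- exact: path_sorted srt.
- move=> k hk; have := order_path_min tr srt => /allP /(_ _ hk); exact.
set x := wact _ _ in dx xr xb nx.
have hx : regular n x by apply/regular_wact/regular_rho.
have xj : x j = Posz (n - j) by rewrite xr.
rewrite /flip_product /= wact_cat -/x wact_desc_last //; split.
- move=> a c hac hc; have h1 : (a < n.-1) by lia.
  rewrite h1; case: (ltnP c j) => cj; first by rewrite (ltn_trans hac cj); apply: dx; lia.
  case: (ltnP c n.-1) => cn; first by case: ifP => ?; apply: dx; lia.
  have -> : c = n.-1 by lia.
  rewrite eqxx xj; case: ifP => aj.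
    by rewrite xr /rho; lia.
  by have := xb a.+1; lia.
- by move=> m hm; rewrite (leq_trans hm bj) xr //; lia.
- move=> m h1 h2; case: ifP => mj; first by rewrite xr /rho; lia.
  case: ifP => mn; first by have := xb m.+1; lia.
  by case: ifP => ?; [rewrite xj|]; lia.
- rewrite -wact_desc_last // ninv_desc_last // ?nx ?size_cat 1?addnC //.
  by rewrite xj; lia.
Qed.

Lemma normal_word_reduced w : normal_word w -> reduced w.
Proof.
case=> i [js [hi srt ->]]; rewrite /reduced size_cat wact_cat.
rewrite -/(desc_product n.-1 i) -/(flip_product js).
have [||dx _ _ nx] := @flip_productP js 0 _ srt; [by []|by []|].
have [n0|n0] := posnP n.
  have -> : desc_product n.-1 i = [::] by rewrite /desc_product (_ : n.-1 = 0) ?n0.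
  by rewrite nx.
rewrite ninv_desc_product ?nx 1?addnC //; first lia.
exact/regular_wact/regular_rho.
Qed.

Lemma insert_next m x : m.+1 < n -> regular n x -> decreasing_upto m x ->
  exists i z, [/\ i <= m.+1, x = wact (desc n m i) z & decreasing_upto m.+1 z].
Proof.
move=> hm [_ h2 _ _] dx.
(* [i] will be the place at which [x m.+1] has to be inserted into the decreasing run, and [z] the
   run after this insertion. *)
have ex : exists i, (x i <= x m.+1)%R by exists m.+1.
case: (ex_minnP ex) => i hi imin.
have im : i <= m.+1 by apply: imin.
have big j : j < i -> (x m.+1 < x j)%R.
  by move=> ji; have : ~ (x j <= x m.+1)%R; [move/imin; lia | lia].
pose z j := if j < i then x j else if j == i then x m.+1
            else if j <= m.+1 then x j.-1 else x j.
exists i, z; split=> //.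
  rewrite wact_val map_val_desc; last lia.
  rewrite act_cycle; last lia.
  have -> : i + (m.+1 - i) = m.+1 by lia.
  apply: funext => j; rewrite /z; case: (ltnP j i) => // ji.
  have -> : (j.+1 < i) = false by lia.
  have -> : (j.+1 == i) = false by lia.
  case: ifP => jm /=; first by rewrite jm.
  rewrite ltnn eqxx; case: eqP => [->//|jm'].
  have -> : (j == i) = false by lia.
  by have -> : (j <= m.+1) = false by lia.
move=> a b ab bm; rewrite /z bm.
have -> : a <= m.+1 by lia.
case: (ltnP b i) => bi; first by rewrite (ltn_trans ab bi); apply: dx; lia.
case: (ltnP a i) => ai.
  by case: eqP => b_i; [apply: big|apply: dx; lia].
have -> : (b == i) = false by lia.
case: eqP => a_i; last by apply: dx; lia.
have h : b.-1 < m.+1 by lia.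
have ib : (x b.-1 <= x i)%R.
  by have [->//|d] := eqVneq (b.-1) i; apply: Order.POrderTheory.ltW; apply: dx; lia.
have := h2 b.-1 m.+1; lia.
Qed.

Lemma sort_prefix m x : m < n -> regular n x -> exists i y,
  [/\ forall l, l < m -> i l <= l.+1, x = wact (desc_product m i) y
    & decreasing_upto m y].
Proof.
move=> + hx; elim: m => [|m IH] hm.
  by exists id, x; split=> // a b; lia.
have [|i [y [hi xy dy]]] := IH; first by lia.
have hy : regular n y.
  by rewrite -(wact_rev (desc_product m i) y) -xy; apply: regular_wact.
have [k [z [hk yz dz]]] := insert_next hm hy dy.
exists (fun l => if l == m then k else i l), z; split=> //.
  by move=> l; case: eqP => [->//|lm] hl; apply: hi; lia.
rewrite desc_productS eqxx wact_cat -yz xy; congr wact.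
rewrite /desc_product; congr flatten; apply/eq_in_map => l.
by rewrite mem_iota; case: eqP => //; lia.
Qed.

(** The last entry is the smallest. If it is negative, its opposite [c] is put back at its place [i]
    among the decreasing entries, and [i] becomes the first index of [js]. The hypothesis on [b]
    forces [b <= i], which makes [js] increasing; [d] bounds the number of flips left. *)
Lemma flip_negatives d b x : n <= b + d -> regular n x ->
  decreasing_upto n.-1 x -> (forall m, m < b -> (- x n.-1 < x m)%R) ->
  exists js, [/\ sorted (fun x y : 'I_n => x < y) js,
    {in js, forall j : 'I_n, b <= j} & x = wact (flip_product js) (rho n)].
Proof.
elim: d b x => [|d IH] b x hbd hx dx hb.
  exists [::]; split=> //=; apply: no_descent_rho => // i.
  have hi := ltn_ord i; rewrite /descent; case: ifP => h.
    by have := dx i i.+1; lia.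
  have := hb i; have -> : nat_of_ord i = n.-1 by lia.
  by lia.
have [h1 h2 _ h4] := hx.
have [xn|xn] := Order.TotalTheory.leP 0%R (x n.-1).
  exists [::]; split=> //=; apply: no_descent_rho => // i.
  have hi := ltn_ord i; rewrite /descent; case: ifP => h.
    by have := dx i i.+1; lia.
  have -> : nat_of_ord i = n.-1 by lia.
  by lia.
pose c := (- x n.-1)%R.
have ex : exists i, (x i < c)%R by exists n.-1; rewrite /c; lia.
case: (ex_minnP ex) => i hi imin.
have ile : i <= n.-1 by apply: imin; rewrite /c; lia.
have lin : i < n.
  by rewrite ltnNge; apply/negP => ni; have := h4 n.-1; lia.
have big j : j < i -> (c < x j)%R.
  move=> ji; have cj : (c <= x j)%R.
    by have : ~ (x j < c)%R; [move/imin; lia | lia].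
  by have := h1 j n.-1; rewrite /c in cj *; lia.
pose z j := if j < i then x j else if j == i then c
            else if j <= n.-1 then x j.-1 else x j.
have xz : x = wact (desc n n.-1 i) z.
  rewrite wact_desc_last //; apply: funext => j; rewrite /z.
  case: (ltnP j i) => // ji.
  have -> : (j.+1 < i) = false by lia.
  have -> : (j.+1 == i) = false by lia.
  case: ifP => jm /=; first by rewrite jm.
  rewrite ltnn eqxx; case: eqP => [->|jm']; first by rewrite /c opprK.
  have -> : (j == i) = false by lia.
  by have -> : (j <= n.-1) = false by lia.
have dz : decreasing_upto n.-1 z.
  move=> p q pq qn; rewrite /z qn.
  have -> : p <= n.-1 by lia.
  case: (ltnP q i) => qi; first by rewrite (ltn_trans pq qi); apply: dx; lia.
  case: (ltnP p i) => pi.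
    by case: eqP => q_i; [apply: big|apply: dx; lia].
  have -> : (q == i) = false by lia.
  case: eqP => p_i; last by apply: dx; lia.
  have [->//|dq] := eqVneq (q.-1) i.
  by have := dx i q.-1; lia.
have hz : regular n z.
  by rewrite -(wact_rev (desc n n.-1 i) z) -xz; apply: regular_wact.
have bi : b <= i.
  by rewrite leqNgt; apply/negP => /hb; rewrite /c in hi; lia.
have zb m : m < i.+1 -> (- z n.-1 < z m)%R.
  move=> mi; have zm : (c <= z m)%R.
    rewrite /z; case: ifP => mi'; first by have := big m mi'; lia.
    by have -> : m == i by lia.
  have [e|ne] := eqVneq n.-1 i.
    have -> : z n.-1 = c by rewrite /z e ltnn eqxx.
    by rewrite /c in zm *; lia.
  have -> : z n.-1 = x n.-2.
    by rewrite /z (negbTE ne) leqnn; have -> : (n.-1 < i) = false by lia.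
  by have := dx n.-2 n.-1; rewrite /c in zm; lia.
have [js [srt hjs zE]] : exists js, [/\ sorted (fun x y : 'I_n => x < y) js,
    {in js, forall j : 'I_n, i.+1 <= j} & z = wact (flip_product js) (rho n)].
  by apply: IH => //; lia.
exists (Ordinal lin :: js); split.
- rewrite /= path_min_sorted //; apply/allP => j /hjs; exact.
- by move=> j; rewrite inE => /orP[/eqP->//|/hjs]; lia.
- by rewrite /flip_product /= wact_cat -/(flip_product js) -zE.
Qed.

Lemma normal_word_exists x : 0 < n -> regular n x ->
  exists2 w : seq 'I_n, normal_word w & wact w (rho n) = x.
Proof.
move=> n0 hx; have [|i [y [hi xy dy]]] := @sort_prefix n.-1 x _ hx; first lia.
have hy : regular n y.
  by rewrite -(wact_rev (desc_product n.-1 i) y) -xy; apply: regular_wact.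
have [js [srt _ yE]] := @flip_negatives n 0 y (leqnn n) hy dy ltac:(by []).
exists (desc_product n.-1 i ++ flip_product js); last by rewrite wact_cat -yE.
by exists i, js; split.
Qed.


End NormalWords.

(** * The Coxeter group *)

Section PositiveWords.
Variables (T : choiceType) (R : seq T -> seq T -> Prop).
Local Notation pos w := [seq (x, true) | x <- w].

Lemma word_prod_cat (M : groupType) (f : T -> M) u v :
  (word_prod f (u ++ v) = word_prod f u * word_prod f v)%g.
Proof. exact: big_cat. Qed.

Lemma word_prod_cons (M : groupType) (f : T -> M) x v :
  (word_prod f (x :: v) = f x * word_prod f v)%g.
Proof. exact: big_cons. Qed.

Lemma word_prod1 (M : groupType) (f : T -> M) x : word_prod f [:: x] = f x.
Proof. exact: big_seq1. Qed.

Lemma word_prod_nil (M : groupType) (f : T -> M) : word_prod f [::] = 1%g.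
Proof. exact: big_nil. Qed.

Lemma pg_class_cat u v :
  (pg_class R (u ++ v) : presented_group R) = (pg_class R u * pg_class R v)%g.
Proof. by symmetry; exact: pg_mulE. Qed.

Lemma word_prod_gen w : word_prod (pg_gen R) w = pg_class R (pos w).
Proof.
elim: w => [|x w IH]; first exact: word_prod_nil.
by rewrite word_prod_cons IH; symmetry; exact: (pg_class_cat [:: (x, true)]).
Qed.

Lemma cong_word_prod u v :
  cong R u v -> word_prod (pg_gen R) u = word_prod (pg_gen R) v.
Proof.
elim=> [//|a b _ ->//|a b c _ -> _ ->//|a b c d h].
rewrite !word_prod_cat; congr (_ * (_ * _))%g.
rewrite !word_prod_gen; apply/pg_classP.
rewrite -[X in cong _ X]cats0 -[X in cong _ _ X]cats0.
exact/(cong_rel [::])/group_rel_rel.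
Qed.

Lemma pg_class_inv x : (pg_class R [:: (x, false)] : presented_group R) = (pg_gen R x)^-1%g.
Proof.
symmetry; apply: mulg1_eq.
apply: etrans (esym (pg_class_cat [:: (x, true)] [:: (x, false)])) _.
apply/pg_classP.
exact: (cong_rel [::] [::] (group_rel_inv R x true)).
Qed.

End PositiveWords.

Lemma cong_sub T (R S : seq T -> seq T -> Prop) u v :
  (forall a b, R a b -> cong S a b) -> cong R u v -> cong S u v.
Proof.
move=> sub; elim=> [a|a b _|a b c _ h1 _ h2|a b c d /sub h].
- exact: cong_refl.
- exact: cong_sym.
- exact: cong_trans h1 h2.
- exact/cong_catl/cong_catr.
Qed.

(* Equal products of group elements may differ by the inferred structure paths,
   which [lia] does not see through; [move:] abstracts lengths up to conversion. *)
Ltac len_lia :=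
  intros; repeat match goal with H : context [len _] |- _ => move: H end;
  repeat match goal with |- context [@len ?n ?t] => move: (@len n t) => ? end;
  lia.

(** * The action, the length, the prefix order and the longest element *)

Section CoxeterGroup.
Variable n : nat.
Local Open Scope group_scope.
Local Notation G := (coxeterB n).
Local Notation s := (@gen_s n).
Local Notation prod := (word_prod (@gen_s n)).
Implicit Types (i : 'I_n) (x y : nat -> int) (u v w p q : seq 'I_n) (g h : G).

Definition gact g x : nat -> int := wact (unzip1 (repr g)) x.

Lemma cong_wact (u v : seq ('I_n * bool)) x :
  cong (group_rel (@coxeterB_rel n)) u v -> wact (unzip1 u) x = wact (unzip1 v) x.
Proof.
move=> h; elim: h x => [//|a b _ IH|a b c _ IH1 _ IH2|a b c d hr] x.
- by rewrite IH.
- by rewrite IH1.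
- rewrite /unzip1 !map_cat !wact_cat; congr wact.
  case: hr => [{}b {}c h|i e] /=; last by rewrite actK.
  by rewrite -!map_comp !map_id; apply: wact_coxeter.
Qed.

Lemma gact_class (u : seq ('I_n * bool)) x :
  gact (pg_class (@coxeterB_rel n) u : G) x = wact (unzip1 u) x.
Proof. by apply: cong_wact; apply/pg_classP; rewrite pg_classK. Qed.

Lemma gactM g h x : gact (g * h) x = gact g (gact h x).
Proof.
by rewrite -[g * h]/(pg_class _ (repr g ++ repr h)) gact_class /unzip1 map_cat wact_cat.
Qed.

Lemma gact_prod w x : gact (prod w) x = wact w x.
Proof. by rewrite word_prod_gen gact_class /unzip1 -map_comp map_id. Qed.

Lemma gact1 x : gact 1 x = x.
Proof. by have := gact_prod [::] x; rewrite word_prod_nil. Qed.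

Lemma gact_gen i x : gact (s i) x = act n i x.
Proof. by have := gact_prod [:: i] x; rewrite word_prod1. Qed.

Lemma gen_sK i : s i * s i = 1.
Proof.
have := cong_word_prod (cong_rel [::] [::] (coxeterB_sq i)).
by rewrite /= word_prod_cons word_prod1 word_prod_nil.
Qed.

Lemma gen_sV i : (s i)^-1 = s i.
Proof. exact/mulg1_eq/gen_sK. Qed.

Lemma prod_rev w : prod (rev w) = (prod w)^-1.
Proof.
elim: w => [|i w IH]; first by rewrite word_prod_nil invg1.
by rewrite rev_cons -cats1 word_prod_cat IH word_prod1 word_prod_cons invgM gen_sV.
Qed.

Lemma gactV w x : gact (prod w)^-1 x = wact (rev w) x.
Proof. by rewrite -prod_rev gact_prod. Qed.

Lemma reduced_expression g : exists2 w, reduced w & prod w = g.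
Proof.
have [w <-] : exists w, prod w = g.
  exists (unzip1 (repr g)); rewrite -[RHS]pg_classK.
  elim: (repr g) => [|[i e] u IH] /=; first exact: word_prod_nil.
  rewrite word_prod_cons IH -[_ :: u]/([:: (i, e)] ++ u) [in RHS]pg_class_cat.
  by congr (_ * _); case: e => //; rewrite pg_class_inv gen_sV.
have [u ru hu] := coxeter_reduce w.
by exists u => //; apply/esym/cong_word_prod.
Qed.

Lemma cong_artin_prod u v : cong (@artinB_rel n) u v -> prod u = prod v.
Proof.
move=> h; apply: cong_word_prod; apply: cong_sub h => a b h.
by rewrite -[a]cats0 -[b]cats0; apply/(cong_rel [::])/coxeterB_artin.
Qed.

Lemma gact_rho_inj g h : gact g (rho n) = gact h (rho n) -> g = h.
Proof.
have [u ru <-] := reduced_expression g; have [v rv <-] := reduced_expression h.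
by rewrite !gact_prod => e; apply/cong_artin_prod/matsumoto.
Qed.

Lemma regular_gact g : regular n (gact g (rho n)).
Proof. exact/regular_wact/regular_rho. Qed.

Hypothesis n_gt0 : 0 < n.

Lemma nfP g : normal_word (nf g) /\ prod (nf g) = g.
Proof.
rewrite /nf; apply: (@xgetPex _ [::] [set w | normal_word w /\ prod w = g]%classic).
have [w nw hw] := normal_word_exists n_gt0 (regular_gact g).
by exists w; split=> //; apply: gact_rho_inj; rewrite gact_prod.
Qed.

Lemma prod_nf g : prod (nf g) = g.
Proof. by case: (nfP g). Qed.

Lemma nf_inj : injective (@nf n).
Proof. by move=> g h e; rewrite -(prod_nf g) e prod_nf. Qed.

Lemma reduced_nf g : reduced (nf g).
Proof. by case: (nfP g) => /normal_word_reduced. Qed.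

Lemma lenE g : len g = ninv n (gact g (rho n)).
Proof. by rewrite -{2}(prod_nf g) gact_prod reduced_nf. Qed.

Lemma len_prod w : len (prod w) <= size w.
Proof.
rewrite lenE gact_prod; apply: leq_trans (ninv_wact_le _ (regular_rho n)) _.
by rewrite ninv_rho addn0.
Qed.

Lemma reduced_len w : reduced w <-> len (prod w) = size w.
Proof. by rewrite lenE gact_prod. Qed.

Lemma len1 : len (1 : G) = 0.
Proof. by rewrite lenE gact1 ninv_rho. Qed.

Lemma len_eq0 g : (len g == 0) = (g == 1).
Proof.
apply/eqP/eqP => [/size0nil h|->]; last exact: len1.
by rewrite -(prod_nf g) h word_prod_nil.
Qed.

Lemma lenM g h : len (g * h) <= len g + len h.
Proof.
by rewrite -{1}(prod_nf g) -{1}(prod_nf h) -word_prod_cat -size_cat; apply: len_prod.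
Qed.

Lemma lenV g : len g^-1 = len g.
Proof.
suff le (k : G) : len k^-1 <= len k by have := le g; have := le g^-1; rewrite invgK; lia.
by rewrite -{1}(prod_nf k) -prod_rev (leq_trans (len_prod _)) // size_rev.
Qed.

Lemma nf_artin u : reduced u -> cong (@artinB_rel n) (nf (prod u)) u.
Proof.
move=> ru; apply: matsumoto => //; first exact: reduced_nf.
by rewrite -gact_prod prod_nf gact_prod.
Qed.

Lemma len_gt0 g : (0 < len g) = (g != 1).
Proof. by rewrite lt0n len_eq0. Qed.

(** The prefix order, also known as the right weak order. *)
Definition ple g h : Prop := len h = len g + len (g^-1 * h).

Lemma plexx g : ple g g.
Proof. by rewrite /ple mulVg len1 addn0. Qed.

Lemma ple1 g : ple 1 g.
Proof. by rewrite /ple len1 invg1 mul1g. Qed.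

Lemma ple_trans g h k : ple g h -> ple h k -> ple g k.
Proof.
rewrite /ple => h1 h2; have := lenM (g^-1 * h) (h^-1 * k).
have := lenM g (g^-1 * k); rewrite mulVKg -mulgA mulVKg; len_lia.
Qed.

Lemma ple_anti g h : ple g h -> ple h g -> g = h.
Proof.
rewrite /ple => h1 h2; have : len (g^-1 * h) == 0 by len_lia.
by rewrite len_eq0 mulg_eq1 => /eqP /invg_inj.
Qed.

Lemma perpE g h : perp g h <-> ple g (g * h).
Proof. by rewrite /perp /ple mulKg. Qed.

Lemma ple_perp g h : ple g h -> perp g (g^-1 * h).
Proof. by rewrite perpE mulVKg. Qed.

Lemma ple_genE i g : ple (s i) g <-> descent n i (gact g (rho n)).
Proof.
rewrite /ple gen_sV.
have lsi : len (s i) <= 1 by rewrite -[s i]word_prod1; apply: (len_prod [:: i]).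
have := lenM (s i) (s i * g); rewrite mulgA gen_sK mul1g.
rewrite !(lenE g) !(lenE (s i * g)) gactM gact_gen => hm.
have hx := regular_gact g.
have [hd|hd] := boolP (descent n i (gact g (rho n))).
  by have := ninv_act_descent (ltn_ord i) hx hd; split=> //; lia.
by have := ninv_act_ascent (ltn_ord i) hx hd; split=> //; lia.
Qed.

Lemma len_gen i : len (s i) = 1%N.
Proof.
have : len (s i) <= 1 by rewrite -[s i]word_prod1; apply: (len_prod [:: i]).
suff : len (s i) != 0 by case: (len _) => [|[|]].
rewrite lenE gact_gen ninv_act_ascent ?ninv_rho //; first exact: regular_rho.
have := ltn_ord i; rewrite /descent /rho; case: ifP; lia.
Qed.

Lemma left_descent_exists g : g != 1 -> exists i, ple (s i) g.
Proof.
move=> g1; apply: contrapT => nd; move/eqP: g1; apply.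
apply: gact_rho_inj; rewrite gact1; apply: no_descent_rho (regular_gact g) _ => i.
by apply/negP => /ple_genE h; apply: nd; exists i.
Qed.

Lemma delta_normal : exists2 w, normal_word w & prod w = delta n /\ size w = (n * n)%N.
Proof.
exists (flatten [seq desc n l 0 | l <- iota 0 n.-1]
         ++ flatten [seq desc n n.-1 j | j : 'I_n <- enum 'I_n]).
  exists (fun=> 0), (enum 'I_n); split=> //.
  by have := iota_ltn_sorted 0 n; rewrite -val_enum_ord sorted_map.
have -> : [seq desc n n.-1 j | j : 'I_n <- enum 'I_n]
        = [seq desc n n.-1 j | j <- iota 0 n].
  by rewrite -val_enum_ord -map_comp.
split=> //; rewrite size_cat !size_flatten /shape -!map_comp.
have sz l j : l < n -> size (desc n l j) = l.+1 - j.
  by move=> hl; rewrite -(size_map val) map_val_desc // size_rev size_iota.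
have -> : map (size \o (fun l => desc n l 0)) (iota 0 n.-1) = map S (iota 0 n.-1).
  by apply/eq_in_map => l; rewrite mem_iota /= => hl; rewrite sz ?subn0 //; lia.
have -> : map (size \o desc n n.-1) (iota 0 n) = map (fun j => n - j) (iota 0 n).
  by apply/eq_in_map => l; rewrite mem_iota /= => hl; rewrite sz; lia.
(* The two blocks have [n (n - 1) / 2] and [n (n + 1) / 2] letters. *)
case: n n_gt0 => // m _ /=; elim: m => [|m IH] //.
rewrite -(addn1 m) iotaD map_cat sumn_cat /= addn0 add0n addn1.
rewrite (iotaDl 1 0) -map_comp.
have -> : map (subn m.+2 \o addn 1) (iota 0 m.+1) = map (fun j => m.+1 - j) (iota 0 m.+1).
  exact: eq_map.
by move: IH => /=; nia.
Qed.

(** The pairs of indices encode the [n^2] positive roots, none of which vanishes at a regular point;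
    negation exchanges those that are positive at [x] with those that are negative. *)
Lemma ninv_opp x : regular n x -> ninv n (fun j => - x j)%R + ninv n x = (n * n)%N.
Proof.
move=> hx; rewrite -[n in (n * n)%N]card_ord -card_prod.
rewrite -(cardC [pred p : 'I_n * 'I_n | (pos_root p.1 p.2 x < 0)%R]) addnC.
congr (_ + _)%N; apply: eq_card => -[a b]; rewrite !inE /=.
have := regular_pos_root hx (ltn_ord a) (ltn_ord b).
by rewrite /pos_root; case: ifP; lia.
Qed.

Lemma regular_opp x : regular n x -> regular n (fun j => - x j)%R.
Proof.
case=> h1 h2 h3 h4; split=> [i j hi hj|i j hi hj|j hj|j hj].
- by have := h1 i j hi hj; lia.
- by have := h2 i j hi hj; lia.
- by have := h3 j hj; lia.
- by have := h4 j hj; lia.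
Qed.

Lemma len_delta : len (delta n) = (n * n)%N.
Proof.
by have [w /normal_word_reduced /reduced_len h [<- <-]] := delta_normal.
Qed.

(** Since [delta] reaches the largest possible number [n^2] of inversions, [- delta rho] has none
    and is therefore [rho]. *)
Lemma gact_delta_rho : gact (delta n) (rho n) = fun j => (- rho n j)%R.
Proof.
have hx := regular_gact (delta n); have := ninv_opp hx.
rewrite -lenE len_delta => h.
have /(ninv0_rho (regular_opp hx)) e : ninv n (fun j => - gact (delta n) (rho n) j)%R = 0 by lia.
by apply: funext => j; rewrite -[in RHS]e opprK.
Qed.

(* Every regular [x] is [f \o rho] for an odd [f], so this transfers
   [delta rho = - rho] to [x]. *)
Lemma wact_comp (f : int -> int) w x : (forall a, f (- a)%R = (- f a)%R) ->
  wact w (f \o x) = f \o wact w x.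
Proof.
move=> fN; elim: w => //= i w ->; apply: funext => j; rewrite /act.
by case: ifP => _ /=; do ?case: ifP.
Qed.

Lemma gact_delta x : regular n x -> gact (delta n) x = fun j => (- x j)%R.
Proof.
move=> [_ _ _ h4]; pose f (a : int) : int :=
  if (0 < a)%R then x (n - absz a) else if (a < 0)%R then (- x (n - absz a)%N)%R else 0%R.
have fN a : f (- a)%R = (- f a)%R.
  by rewrite /f abszN; case: a => [[|a]|a] //=; rewrite ?opprK ?oppr0.
have e : x = f \o rho n.
  apply: funext => j; rewrite /f /rho /=; have [hj|hj] := ltnP j n.
    have -> : (0 < Posz (n - j))%R by lia.
    by congr x; lia.
  by rewrite h4 // (_ : n - j = 0)%N //; lia.
rewrite {1}e /gact wact_comp // -/(gact _ _) gact_delta_rho.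
by apply: funext => j; rewrite /= fN [in RHS]e.
Qed.

Lemma delta_central g : delta n * g = g * delta n.
Proof.
apply: gact_rho_inj; rewrite !gactM gact_delta ?gact_delta_rho; last exact: regular_gact.
exact: esym (@wact_comp (fun a => - a)%R (unzip1 (repr g)) (rho n) (fun=> erefl)).
Qed.

Lemma len_mul_delta g : len (g * delta n) + len g = (n * n)%N.
Proof.
rewrite -delta_central !lenE gactM gact_delta; last exact: regular_gact.
exact: ninv_opp (regular_gact g).
Qed.

Lemma len_le_delta g : len g <= (n * n)%N.
Proof. by have := len_mul_delta g; lia. Qed.

Lemma ple_delta g : ple g (delta n).
Proof. by rewrite /ple len_delta -(len_mul_delta g^-1) lenV addnC. Qed.

Lemma perp_ple g h : perp g h <-> ple h (g^-1 * delta n).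
Proof.
rewrite /perp /ple mulgA -invgM.
have := len_mul_delta (g * h)^-1; have := len_mul_delta g^-1.
have := len_le_delta g; have := len_le_delta (g * h).
by rewrite !lenV => ? ? ? ?; split=> ?; len_lia.
Qed.

Lemma delta_neq1 : delta n != 1.
Proof. by rewrite -len_gt0 len_delta muln_gt0 n_gt0. Qed.

Lemma len_eq_delta g : len g = (n * n)%N -> g = delta n.
Proof.
move=> h; have := ple_delta g; rewrite /ple h len_delta => h0.
have : len (g^-1 * delta n) == 0 by len_lia.
by rewrite len_eq0 mulg_eq1 => /eqP /invg_inj.
Qed.

(** Every generator is a descent at [delta rho], so by [artin_descending] the reverses of both sides
    remove from it one inversion per letter. *)
Lemma artin_reduced u v : artinB_rel u v -> reduced u /\ reduced v.
Proof.
move=> h; have hx := regular_gact (delta n).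
have /andP[du dv] : descending (rev u) (gact (delta n) (rho n)) &&
    descending (rev v) (gact (delta n) (rho n)).
  by apply: artin_descending h _ => i _; apply/ple_genE/ple_delta.
have red w : descending (rev w) (gact (delta n) (rho n)) -> reduced w.
  move=> /(ninv_descending hx); rewrite -gactV -gactM -!lenE len_delta size_rev => e.
  have := ple_delta (prod w); rewrite reduced_len /ple len_delta => ?; len_lia.
by split; apply: red.
Qed.

Lemma common_upper_bound (i j : 'I_n) : i != j -> exists u : G,
  [/\ ple (s i) u, ple (s j) u
    & forall g, ple (s i) g -> ple (s j) g -> ple u g].
Proof.
move=> /common_descents [p [q [hpq _ red]]].
have e : prod (i :: p) = prod (j :: q) by apply: cong_artin_prod.
have hu g : ple (s i) g -> ple (s j) g ->
    len g = size (i :: p) + len ((prod (i :: p))^-1 * g) /\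
    len g = size (j :: q) + len ((prod (j :: q))^-1 * g).
  move=> /ple_genE hi /ple_genE hj; have [r1 r2] := red _ (regular_gact g) hi hj.
  by rewrite !lenE !gactM !gactV; split; lia.
(* Applied to [delta], which has every element as a prefix, these equalities force both words to be
   reduced. *)
have [h1 h2] := hu _ (ple_delta (s i)) (ple_delta (s j)).
have := lenM (prod (i :: p)) ((prod (i :: p))^-1 * delta n).
have := lenM (prod (j :: q)) ((prod (j :: q))^-1 * delta n).
have := len_prod (i :: p); have := len_prod (j :: q).
have := len_prod p; have := len_prod q.
have := lenM (s i) (prod p); have := lenM (s j) (prod q).
rewrite !mulVKg -!word_prod_cons !len_gen /= => ? ? ? ? ? ? ? ?.
exists (prod (i :: p)); split.
- by rewrite /ple word_prod_cons mulKg -word_prod_cons len_gen; rewrite /= in h1 h2; len_lia.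
- by rewrite e /ple word_prod_cons mulKg -word_prod_cons len_gen; rewrite /= in h1 h2; len_lia.
- by move=> g hi hj; have [h3 h4] := hu g hi hj; rewrite /ple; rewrite /= in h1 h2 h3; len_lia.
Qed.

End CoxeterGroup.

(** * Greedy normal forms *)

Section GreedyNormalForm.
Variable n : nat.
Hypothesis n_gt0 : 0 < n.
Local Open Scope group_scope.
Local Notation G := (coxeterB n).
Local Notation s := (@gen_s n).
Local Notation delta := (delta n).
Implicit Types (i j : 'I_n) (a b c d g h : G) (w : seq G).

Lemma ple_mul2l h g (k : G) : ple g k -> perp h k -> ple (h * g) (h * k) /\ perp h g.
Proof.
rewrite /perp /ple => h1 h2; have := lenM n_gt0 (h * g) (g^-1 * k); have := lenM n_gt0 h g.
by rewrite invgM -!mulgA mulKg mulVKg; split; len_lia.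
Qed.

Lemma ple_mul2lV h g (k : G) : perp h g -> ple (h * g) k -> ple h k /\ ple g (h^-1 * k).
Proof.
rewrite /perp /ple => h1 h2; have := lenM n_gt0 h (h^-1 * k).
have := lenM n_gt0 g (g^-1 * (h^-1 * k)).
by move: h2; rewrite invgM -!mulgA !mulVKg; split; len_lia.
Qed.

Lemma ple_next g h : ple g h -> g != h ->
  exists i, perp g (s i) /\ ple (g * s i) h.
Proof.
move=> gh ne; have [|i hi] := @left_descent_exists _ n_gt0 (g^-1 * h).
  by rewrite mulg_eq1 (inj_eq invg_inj).
have [h1 h2] := ple_mul2l hi (ple_perp gh).
by exists i; rewrite mulVKg in h1.
Qed.

Lemma perp_ple_mul g h : perp g h -> ple g (g * h).
Proof. by move/perpE. Qed.

(** Induction on the distance from [x] to [delta]: for any extension [x s_i] of [x] below both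
    elements, the meet above [x s_i] is already the meet above [x]. *)
Lemma meet_above b b' x : ple x b -> ple x b' -> exists m,
  [/\ ple m b, ple m b', ple x m
    & forall d, ple x d -> ple d b -> ple d b' -> ple d m].
Proof.
elim: {x}(n * n - len x)%N {-2}x (leqnn (n * n - len x)) => [|l IH] x hl xb xb'.
  have ex : x = delta by apply: len_eq_delta => //; have := len_le_delta n_gt0 x; lia.
  exists x; split=> //; first exact: plexx.
  by move=> d _ _ _; rewrite ex; apply: ple_delta.
have [[i [xi [xib xib']]]|ni] :=
    pselect (exists i, perp x (s i) /\ ple (x * s i) b /\ ple (x * s i) b'); last first.
  exists x; split=> //; first exact: plexx.
  move=> d xd db db'; have [->|ne] := eqVneq x d; first exact: plexx.
  have [i [h1 h2]] := ple_next xd ne; case: ni; exists i.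
  by split=> //; split; apply: ple_trans h2 _.
have step j : perp x (s j) -> (n * n - len (x * s j) <= l)%N.
  rewrite /perp len_gen // => e.
  by have := len_le_delta n_gt0 (x * s j); len_lia.
have [m [mb mb' xim hm]] := IH _ (step i xi) xib xib'.
have xm : ple x m by apply: ple_trans xim => //; apply: perp_ple_mul.
exists m; split=> // d xd db db'.
have [<-//|ne] := eqVneq x d.
have [j [xj xjd]] := ple_next xd ne.
have [eij|nij] := eqVneq i j; first by apply: hm => //; rewrite eij.
have xjb : ple (x * s j) b by apply: ple_trans db.
have xjb' : ple (x * s j) b' by apply: ple_trans db'.
have [u [iu ju hu]] := common_upper_bound n_gt0 nij.
have up c : ple (x * s i) c -> ple (x * s j) c -> perp x u /\ ple (x * u) c.
  move=> hi hj; have [xc si] := ple_mul2lV xi hi; have [_ sj] := ple_mul2lV xj hj.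
  by have [] := ple_mul2l (hu _ si sj) (ple_perp xc); rewrite mulVKg.
have [xu xub] := up b xib xjb; have [_ xub'] := up b' xib' xjb'.
have [xixu _] := ple_mul2l iu xu; have [xjxu _] := ple_mul2l ju xu.
have [m' [m'b m'b' xjm' hm']] := IH _ (step j xj) xjb xjb'.
(* The common extension [x u] lies below [b] and [b'], hence below [m']; so [m'] lies above [x s_i]
   and thus below the meet [m] taken there. *)
have m'm : ple m' m.
  by apply: hm => //; apply: ple_trans xixu _ => //; apply: hm'.
by apply: ple_trans m'm => //; apply: hm'.
Qed.

(* The longest prefix of [b] which can be moved into the factor [a]; it exists by
   [meet_above], so the default value 1 plays no role. *)
Definition absorb a b : G :=
  xget 1 [set m | [/\ ple m b, perp a m
    & forall d, ple d b -> perp a d -> ple d m]]%classic.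

Lemma absorbP a b : [/\ ple (absorb a b) b, perp a (absorb a b)
  & forall d, ple d b -> perp a d -> ple d (absorb a b)].
Proof.
apply: (@xgetPex _ _ [set m | [/\ ple m b, perp a m
  & forall d, ple d b -> perp a d -> ple d m]]%classic).
have [m [mb md _ hm]] := meet_above (ple1 n_gt0 b) (ple1 n_gt0 (a^-1 * delta)).
exists m; split=> //; first by apply/perp_ple.
move=> d db /(perp_ple n_gt0) da; apply: hm => //; exact: ple1.
Qed.

Lemma absorb_eq a b m : ple m b -> perp a m ->
  (forall d, ple d b -> perp a d -> ple d m) -> absorb a b = m.
Proof.
have [h1 h2 h3] := absorbP a b => m1 m2 m3.
by apply: ple_anti => //; [apply: m3|apply: h3].
Qed.

(** Left multiplication on greedy sequences: [a] takes over the absorbable prefix of [b], and the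
    rest of [b] is carried into the tail until nothing is left to carry. *)
Fixpoint ins a w : seq G :=
  if a == 1 then w
  else if w is b :: w' then a * absorb a b :: ins ((absorb a b)^-1 * b) w' else [:: a].

Lemma ins1 w : ins 1 w = w.
Proof. by case: w => [|b w] /=; rewrite eqxx. Qed.

Lemma perp_neq1 a b : perp a b -> a != 1 -> a * b != 1.
Proof. by rewrite /perp -!(len_gt0 n_gt0) => ->; lia. Qed.

(** The left side begins with [b], since [b] can be absorbed into [a]. What follows is a prefix of
    [absorb b c], hence of [c], and can be absorbed into [a * b]. Conversely, what [a * b] absorbs
    from [c] can be absorbed into [b]. *)
Lemma absorb_mul a b c : perp a b ->
  absorb a (b * absorb b c) = b * absorb (a * b) c.
Proof.
move=> ab; have [pc bp hp] := absorbP b c; have [mc abm hm] := absorbP (a * b) c.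
set p := absorb b c in pc bp hp *; set m := absorb (a * b) c in mc abm hm *.
have bm : perp b m.
  have := lenM n_gt0 b m; have := lenM n_gt0 a (b * m).
  by move: abm ab; rewrite /perp -mulgA => ? ? ? ?; len_lia.
have mp := hp _ mc bm.
have [bmbp _] := ple_mul2l mp bp.
have abm' : perp a (b * m).
  by move: abm ab bm; rewrite /perp -mulgA => ? ? ?; len_lia.
apply: absorb_eq => // d dbp ad; have [q1 q2 q3] := absorbP a (b * p).
set q := absorb a (b * p) in q1 q2 q3.
have dq : ple d q by apply: q3.
apply: ple_trans dq _ => //.
have bq : ple b q by apply: q3 => //; apply: perp_ple_mul.
have bq' := ple_perp bq.
have [_ q'p] : ple b (b * p) /\ ple (b^-1 * q) (b^-1 * (b * p)).
  by apply: ple_mul2lV => //; rewrite mulVKg.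
rewrite mulKg in q'p.
have q'm : ple (b^-1 * q) m.
  apply: hm; first exact: ple_trans q'p pc.
  move: q2 ab bq'; rewrite /perp -mulgA mulVKg => ? ? ?; len_lia.
by have [] := ple_mul2l q'm bm; rewrite mulVKg.
Qed.

(** This makes insertion respect r(a) r(b) = r(ab). The heads agree by [absorb_mul]; the two carries
    again multiply with lengths adding, so induction applies to the tails. *)
Lemma ins_ins a b w : perp a b -> ins a (ins b w) = ins (a * b) w.
Proof.
elim: w a b => [|c w IH] a b ab.
  have [->|a1] := eqVneq a 1; first by rewrite ins1 mul1g.
  have [->|b1] := eqVneq b 1; first by rewrite ins1 mulg1.
  rewrite /= (negbTE b1) (negbTE (perp_neq1 ab a1)) /= (negbTE a1).
  rewrite (@absorb_eq a b b) ?mulVg ?eqxx //; exact: plexx.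
have [->|a1] := eqVneq a 1; first by rewrite ins1 mul1g.
have [->|b1] := eqVneq b 1; first by rewrite ins1 mulg1.
rewrite /= (negbTE b1) (negbTE (perp_neq1 ab a1)) /= (negbTE a1).
rewrite absorb_mul // mulgA; congr (_ :: _).
have [pc bp hp] := absorbP b c; have [mc abm hm] := absorbP (a * b) c.
set p := absorb b c in pc bp hp *; set m := absorb (a * b) c in mc abm hm *.
have bm : perp b m.
  have := lenM n_gt0 b m; have := lenM n_gt0 a (b * m).
  by move: abm ab; rewrite /perp -mulgA => ? ? ? ?; len_lia.
have mp := hp _ mc bm.
have e : (b * m)^-1 * (b * p) = m^-1 * p by rewrite invgM -mulgA mulKg.
rewrite e IH; first by rewrite -mulgA mulVKg.
move: mc mp pc; rewrite /ple /perp -mulgA mulVKg => ? ? ?; len_lia.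
Qed.

(** As [delta] factors both as [a (a^-1 delta)] and as [(a^-1 delta) a], both sides equal
    [ins a (ins (a^-1 * delta) (ins a w))]. *)
Lemma ins_delta_comm a w : ins a (ins delta w) = ins delta (ins a w).
Proof.
have e : (a^-1 * delta) * a = delta by rewrite -mulgA delta_central // mulKg.
have p1 : perp (a^-1 * delta) a.
  by rewrite /perp e (ple_delta n_gt0 a) addnC.
have p2 : perp a (a^-1 * delta) by apply/ple_perp/ple_delta.
by rewrite -{1}e -ins_ins // ins_ins // mulVKg.
Qed.

Definition greedy w : bool :=
  all (predC1 1) w && sorted (fun a b => absorb a b == 1) w.

Lemma ins_greedy a w : greedy (a :: w) -> ins a w = a :: w.
Proof.
elim: w a => [|b w IH] a; rewrite /greedy /=; first by rewrite andbT => /andP[/negbTE ->].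
move=> /andP[/and3P[a1 b1 w1] /andP[/eqP ab p]].
rewrite (negbTE a1) ab mulg1 invg1 mul1g IH //.
by rewrite /greedy /= b1 w1.
Qed.

Lemma foldr_ins_greedy w : greedy w -> foldr ins [::] w = w.
Proof.
elim: w => //= a w IH h; rewrite IH; first exact: ins_greedy.
by move: h; rewrite /greedy /= => /andP[/andP[_ ->] /path_sorted].
Qed.

Lemma absorb_delta a : absorb delta a = 1.
Proof.
have [_ + _] := absorbP delta a; rewrite /perp => e.
have := len_le_delta n_gt0 (delta * absorb delta a).
have := len_delta n_gt0; have h : len (absorb delta a) == 0 -> absorb delta a = 1.
  by rewrite len_eq0 // => /eqP.
by move=> ? ?; apply: h; len_lia.
Qed.

Lemma greedy_delta k w : greedy w -> greedy (nseq k delta ++ w).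
Proof.
move=> /andP[h1 h2]; rewrite /greedy all_cat h1 all_nseq /= (delta_neq1 n_gt0) orbT /=.
elim: k => //= k IH; case: k IH => [|k] /= IH; last by rewrite absorb_delta eqxx.
by case: w h1 h2 {IH} => //= a w _ ->; rewrite absorb_delta eqxx.
Qed.

Lemma iter_ins_delta k w : greedy w -> iter k (ins delta) w = nseq k delta ++ w.
Proof.
by move=> h; elim: k => //= k ->; apply: ins_greedy; apply: (@greedy_delta k.+1).
Qed.

End GreedyNormalForm.

(** * Uniqueness of normal words over the alphabet *)

Section LetterWords.
Variable n : nat.
Hypothesis n_gt0 : 0 < n.
Local Open Scope group_scope.
Local Notation G := (coxeterB n).
Local Notation delta := (delta n).
Local Notation L := (letter n).
Implicit Types (a b c : G) (l m : L) (u v w : seq L) (X : seq G).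

Lemma rr1 : rr (1 : G) = [::].
Proof. by rewrite /rr insubF // eqxx. Qed.

Lemma rrE a (a1 : a != 1) : rr a = [:: Some (exist _ a a1)].
Proof. by rewrite /rr insubT. Qed.

(** [Delta] being central, a word stands for the power [- negs u] of [Delta] times the product of
    [factors u]. *)
Definition factors u : seq G := pmap (omap val) u.

Definition negs u : nat := count (pred1 None) u.

Lemma factors_cat u v : factors (u ++ v) = factors u ++ factors v.
Proof. exact: pmap_cat. Qed.

Lemma negs_cat u v : (negs (u ++ v) = negs u + negs v)%N.
Proof. exact: count_cat. Qed.

Lemma factors_rr a : a != 1 -> factors (rr a) = [:: a].
Proof. by move=> a1; rewrite rrE. Qed.

Lemma negs_rr a : negs (rr a) = 0.
Proof. by rewrite /rr; case: insub. Qed.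

Lemma iter_ins_comm k a X :
  ins a (iter k (ins delta) X) = iter k (ins delta) (ins a X).
Proof. by elim: k => //= k <-; rewrite ins_delta_comm. Qed.

Lemma foldr_iter_ins k (Y X : seq G) :
  foldr (@ins n) (iter k (ins delta) X) Y = iter k (ins delta) (foldr (@ins n) X Y).
Proof. by elim: Y => //= a Y ->; rewrite iter_ins_comm. Qed.

(** Cross-multiplication: the letters [Delta^-1] of each side are compensated by insertions of
    [delta] on the other side. *)
Lemma braidB_rel_ins u v X : braidB_rel u v ->
  iter (negs v) (ins delta) (foldr (@ins n) X (factors u)) =
  iter (negs u) (ins delta) (foldr (@ins n) X (factors v)).
Proof.
have d1 := delta_neq1 n_gt0.
case=> [e|a b a1 b1 ab].
  by case: e; rewrite factors_cat negs_cat /Delta /= negs_rr factors_rr.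
rewrite factors_cat negs_cat !negs_rr !factors_rr //=; last exact: perp_neq1.
by rewrite ins_ins.
Qed.

(** The surplus [N] makes the statement transitive without a cancellation of [delta]. *)
Lemma cong_braidB_ins u v : cong (@braidB_rel n) u v -> exists N,
  iter (N + negs v)%N (ins delta) (foldr (@ins n) [::] (factors u)) =
  iter (N + negs u)%N (ins delta) (foldr (@ins n) [::] (factors v)).
Proof.
elim=> [w|x y _ [N h]|x y z _ [N1 h1] _ [N2 h2]|x y z t h].
- by exists 0%N.
- by exists N.
- exists (N1 + N2 + negs y)%N.
  have -> : (N1 + N2 + negs y + negs z = N2 + negs z + (N1 + negs y))%N by lia.
  rewrite iterD h1 -iterD addnC iterD h2 -iterD; congr iter; lia.
- exists (negs x + negs t)%N; rewrite !factors_cat !foldr_cat !negs_cat.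
  set X := foldr _ [::] (factors t).
  have e := braidB_rel_ins X h.
  have -> : (negs x + negs t + (negs x + (negs z + negs t)) =
             negs x + negs t + negs x + negs t + negs z)%N by lia.
  have -> : (negs x + negs t + (negs x + (negs y + negs t)) =
             negs x + negs t + negs x + negs t + negs y)%N by lia.
  rewrite !(iterD _ (negs z)) !(iterD _ (negs y)).
  by rewrite -!(foldr_iter_ins _ (factors x)) e.
Qed.

(** The adjacent pairs allowed in a normal word; [nf_edge_step] rewrites all others. *)
Definition nf_edge l m : bool :=
  match l, m with
  | None, None => true
  | Some _, None => false
  | None, Some b => val b != delta
  | Some a, Some b => absorb (val a) (val b) == 1
  end.

Lemma sorted_shape u : sorted nf_edge u ->
  [/\ u = nseq (negs u) None ++ flatten [seq rr a | a <- factors u],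
      greedy (factors u) & 0 < negs u -> ohead (factors u) <> Some delta].
Proof.
elim: u => // l u IH h; have /IH [e g hd] := path_sorted h.
case: l h => [a|] /= h; last first.
  split=> //; first by rewrite {1}e.
  move=> _; case: u h e g hd {IH} => [|[b|] u] //=; last by move=> _ _ _; apply.
  by move=> /andP[/eqP hb _] _ _ _ [].
have n0 : negs u = 0.
  case: (negs u) e h => // k -> /=; first by [].
have e' : u = flatten [seq rr a | a <- factors u] by rewrite {1}e n0.
split.
- rewrite n0 /= {1}e' rrE ?(valP a) // => a1; congr (Some _ :: _); exact: val_inj.
- rewrite /greedy /= (valP a); move: g; rewrite /greedy => /andP[-> g2] /=.
  by case: u h g2 {IH e hd n0 e'} => //= -[b|] u //= /andP[-> _].
- by rewrite n0.
Qed.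

Lemma sorted_cong_eq u v : sorted nf_edge u -> sorted nf_edge v ->
  cong (@braidB_rel n) u v -> u = v.
Proof.
wlog le : u v / negs u <= negs v.
  move=> th su sv h; have [le|/ltnW le] := leqP (negs u) (negs v); first exact: th.
  by symmetry; apply: th => //; apply: cong_sym.
move=> /sorted_shape [eu gu hu] /sorted_shape [ev gv hv] /cong_braidB_ins [N].
rewrite !foldr_ins_greedy // !iter_ins_delta //.
rewrite -(subnKC le) addnA nseqD -catA => /eqP.
rewrite eqseq_cat // eqxx /= => /eqP fE.
(* A positive difference would put [delta] at the head of [factors v], although [v] contains
   [Delta^-1]. *)
have d0 : (negs v - negs u = 0)%N.
  move: hv fE; case: (posnP (negs v - negs u)) => // hp hv fE; exfalso.
  apply: hv; first lia.
  by rewrite -fE; case: (negs v - negs u)%N hp.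
rewrite d0 /= in fE; rewrite eu ev fE; congr (nseq _ _ ++ _); lia.
Qed.

End LetterWords.

(** * Groebner-Shirshov bases of binomials *)

Section DegLex.
Variables (T : eqType) (lt : rel T).
Hypotheses (lt_irr : irreflexive lt) (lt_trans : transitive lt).
Hypothesis lt_total : forall x y, x != y -> lt x y || lt y x.
Implicit Types u v w a b : seq T.

Lemma lexlt_irr : irreflexive (lexlt lt).
Proof. by elim=> //= x u ->; rewrite lt_irr eqxx. Qed.

Lemma lexlt_trans : transitive (lexlt lt).
Proof.
elim=> [|y v IH] [|x u] [|z w] //= /orP[xy|/andP[/eqP xy uv]] /orP[yz|/andP[/eqP yz vw]].
- by rewrite (lt_trans xy yz).
- by rewrite -yz xy.
- by rewrite xy yz.
- by rewrite xy yz eqxx (IH _ _ uv vw) orbT.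
Qed.

Lemma lexlt_total u v : u != v -> lexlt lt u v || lexlt lt v u.
Proof.
elim: u v => [|x u IH] [|y v] //=; rewrite eqseq_cons (eq_sym y x).
have [->|xy] := eqVneq x y; first by rewrite lt_irr /=; apply: IH.
by rewrite /= !orbF => _; apply: lt_total.
Qed.

Lemma lexlt_cat a u v b : size u = size v -> lexlt lt u v ->
  lexlt lt (a ++ u ++ b) (a ++ v ++ b).
Proof.
move=> sz uv; elim: a => [|x a IH] /=; last by rewrite eqxx IH orbT.
elim: u v sz uv => [|x u IH] [|y v] //= [sz] /orP[->//|/andP[-> /(IH _ sz)->]].
by rewrite orbT.
Qed.

Lemma deglex_irr : irreflexive (deglex lt).
Proof. by move=> u; rewrite /deglex ltnn lexlt_irr andbF. Qed.

Lemma deglex_trans : transitive (deglex lt).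
Proof.
move=> v u w; rewrite /deglex.
move=> /orP[uv|/andP[/eqP uv luv]] /orP[vw|/andP[/eqP vw lvw]].
- by rewrite (ltn_trans uv vw).
- by rewrite -vw uv.
- by rewrite uv vw.
- by rewrite uv vw eqxx (lexlt_trans luv lvw) orbT.
Qed.

Lemma deglex_total u v : u != v -> deglex lt u v || deglex lt v u.
Proof.
move=> uv; rewrite /deglex; case: (ltngtP (size u) (size v)) => //= _.
exact: lexlt_total.
Qed.

Lemma deglex_cat a u v b : deglex lt u v -> deglex lt (a ++ u ++ b) (a ++ v ++ b).
Proof.
rewrite /deglex !size_cat ltn_add2l ltn_add2r eqn_add2l eqn_add2r.
move=> /orP[->//|/andP[/eqP e l]]; rewrite e eqxx lexlt_cat ?orbT //.
Qed.

End DegLex.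

Lemma sum_split (V : nmodType) m1 m2 (F : 'I_(m1 + m2) -> V) F1 F2 :
  (forall i, F (lshift m2 i) = F1 i) -> (forall i, F (rshift m1 i) = F2 i) ->
  (\sum_i F1 i + \sum_i F2 i = \sum_i F i)%R.
Proof.
by move=> h1 h2; rewrite big_split_ord; congr (_ + _)%R; apply: eq_bigr => i _.
Qed.

(** * Binomials, compositions and ideals *)

Section BinomialGroebner.
Local Open Scope ring_scope.
Variables (k : fieldType) (Y : choiceType) (lt : rel (seq Y)).
Hypotheses (lt_irr : irreflexive lt) (lt_trans : transitive lt).
Hypothesis lt_total : forall u v, u != v -> lt u v || lt v u.
Hypothesis lt_cat : forall a u v b, lt u v -> lt (a ++ u ++ b) (a ++ v ++ b).
Local Notation mon := (@mon k Y).
Local Notation A := {malg k[{fmonom Y}]}.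
Implicit Types (u v w a b x y : seq Y) (f g h : A) (R S : seq Y -> seq Y -> Prop).

Lemma mon_cat u v : mon u * mon v = mon (u ++ v).
Proof.
rewrite /Defs.mon malgM_def fgmulUU mulr1; congr mkmalgU; exact: fmmulE.
Qed.

Lemma mcoeff_mon u v : (mon u)@_(FMonom v) = (u == v)%:R.
Proof. by rewrite /Defs.mon mcoeffU1. Qed.

Lemma leading_binomial u v : lt v u -> leading lt (mon u - mon v) u.
Proof.
move=> vu; have vu' : v != u by apply: contraTneq vu => ->; rewrite lt_irr.
split=> [|w]; rewrite /in_poly mcoeffB !mcoeff_mon.
  by rewrite eqxx (negbTE vu') subr0 oner_neq0.
move=> + wu; rewrite (eq_sym u) (negbTE wu) sub0r oppr_eq0.
by have [<-//|] := eqVneq v w; rewrite eqxx.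
Qed.

Lemma leading_inj f u v : leading lt f u -> leading lt f v -> u = v.
Proof.
move=> [fu hu] [fv hv]; apply/eqP/negP => /negP uv.
have := hu v fv; rewrite eq_sym => /(_ uv) vu.
by have := lt_irr u; rewrite (lt_trans (hv u fu uv) vu).
Qed.

Lemma gs_monic_binomial u v : lt v u -> gs_monic lt (mon u - mon v).
Proof.
move=> vu; exists u; first exact: leading_binomial.
rewrite mcoeffB !mcoeff_mon eqxx; case: eqP => [e|]; last by rewrite subr0.
by rewrite e lt_irr in vu.
Qed.

Lemma rel_polys_intro R u v : R u v \/ R v u -> lt v u ->
  rel_polys lt R (mon u - mon v).
Proof.
move=> h vu; have uv : u != v by apply: contraTneq vu => ->; rewrite lt_irr.
have m := gs_monic_binomial vu; case: h => h.
  by exists u, v; split; [exact: h|exact: uv|exact: m|left].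
by exists v, u; split; [exact: h|rewrite eq_sym|exact: m|right].
Qed.

Lemma rel_polys_elim R f : rel_polys lt R f -> exists u v,
  [/\ R u v \/ R v u, lt v u & f = mon u - mon v].
Proof.
(* In characteristic 2 both orientations of a relation are monic, but then
   they are equal. *)
have key u v g : gs_monic lt g -> g = mon u - mon v -> lt u v -> g = mon v - mon u.
  move=> [w lw cw] gE uv; move: lw cw; rewrite gE -opprB => lw.
  have lv : leading lt (- (mon v - mon u)) v.
    have [h1 h2] := leading_binomial uv; split; first by rewrite /in_poly mcoeffN oppr_eq0.
    by move=> z; rewrite /in_poly mcoeffN oppr_eq0; apply: h2.
  rewrite (leading_inj lw lv) mcoeffN mcoeffB !mcoeff_mon eqxx.
  have -> : (u == v) = false by apply/eqP => e; rewrite e lt_irr in uv.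
  by rewrite subr0 => e; rewrite -scaleN1r e scale1r.
move=> [u [v [Ruv uv mf hf]]].
have /orP[l|l] := lt_total uv; case: hf => hf.
- by exists v, u; split; [right|exact: l|exact: key mf hf l].
- by exists v, u; split; [right|exact: l|exact: hf].
- by exists u, v; split; [left|exact: l|exact: hf].
- by exists u, v; split; [left|exact: l|exact: key mf hf l].
Qed.

Lemma trivial_mod0 (S : set A) w : trivial_mod lt S w 0.
Proof.
exists 0%N, (fun=> 0), (fun=> [::]), (fun=> [::]), (fun=> 0).
by split=> [[]|[]|] //; rewrite big_ord0.
Qed.

Lemma trivial_modD (S : set A) w f g :
  trivial_mod lt S w f -> trivial_mod lt S w g -> trivial_mod lt S w (f + g).
Proof.
move=> [m1 [c1 [a1 [b1 [s1 [h1 h1' ->]]]]]] [m2 [c2 [a2 [b2 [s2 [h2 h2' ->]]]]]].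
pose gl T (p : 'I_m1 -> T) (q : 'I_m2 -> T) (i : 'I_(m1 + m2)) :=
  match split i with inl j => p j | inr j => q j end.
have glL T (p : 'I_m1 -> T) q i : gl T p q (lshift m2 i) = p i.
  by rewrite /gl (unsplitK (inl i)).
have glR T p (q : 'I_m2 -> T) i : gl T p q (rshift m1 i) = q i.
  by rewrite /gl (unsplitK (inr i)).
exists (m1 + m2)%N, (gl _ c1 c2), (gl _ a1 a2), (gl _ b1 b2), (gl _ s1 s2); split.
- by move=> i; rewrite /gl; case: (split i).
- by move=> i; rewrite /gl; case: (split i).
- by apply: sum_split => i; rewrite ?glL ?glR.
Qed.

Lemma trivial_modN (S : set A) w f : trivial_mod lt S w f -> trivial_mod lt S w (- f).
Proof.
move=> [m [c [a [b [s [h h' ->]]]]]].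
exists m, (fun i => - c i), a, b, s; split=> //.
by rewrite -sumrN; apply: eq_bigr => i _; rewrite scaleNr.
Qed.

Lemma trivial_mod_step (S : set A) w a u v b : S (mon u - mon v) -> lt v u ->
  lt (a ++ u ++ b) w -> trivial_mod lt S w (mon (a ++ u ++ b) - mon (a ++ v ++ b)).
Proof.
move=> hs vu l; exists 1%N, (fun=> 1), (fun=> a), (fun=> b), (fun=> mon u - mon v).
split=> // [_|]; first by exists u => //; apply: leading_binomial.
by rewrite big_ord1 scale1r mulrBr mulrBl !mon_cat !catA.
Qed.

(** A relation may be used in either direction as long as the word decreases, in accordance with the
    leading words of [rel_polys]. *)
Inductive reduces S : seq Y -> seq Y -> Prop :=
| reduces_refl u : reduces S u u
| reduces_step a u v b w : S u v \/ S v u -> lt v u ->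
    reduces S (a ++ v ++ b) w -> reduces S (a ++ u ++ b) w.

Lemma reduces_cong S u v : reduces S u v -> cong S u v.
Proof.
elim=> [x|a x y b w h _ _ IH]; first exact: cong_refl.
apply: cong_trans IH; case: h => h; first exact: cong_rel.
exact/cong_sym/cong_rel.
Qed.

(** The difference telescopes along the reduction, and all words met stay below [w]. *)
Lemma reduces_trivial S w x y : reduces S x y -> lt x w ->
  trivial_mod lt (rel_polys lt S) w (mon x - mon y).
Proof.
elim=> [u|a u v b z h vu _ IH] l; first by rewrite subrr; apply: trivial_mod0.
rewrite -(subrK (mon (a ++ v ++ b)) (mon (a ++ u ++ b))) -addrA.
apply: trivial_modD; last by apply/IH/(lt_trans _ l)/lt_cat.
by apply: trivial_mod_step => //; apply: rel_polys_intro.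
Qed.

Section ConfluentSystem.
Variables (S : seq Y -> seq Y -> Prop) (NF : seq Y -> Prop).
Hypothesis NF_exists : forall x, exists2 y, NF y & reduces S x y.
Hypothesis NF_unique : forall x y, NF x -> NF y -> cong S x y -> x = y.

Lemma cong_trivial w x y : cong S x y -> lt x w -> lt y w ->
  trivial_mod lt (rel_polys lt S) w (mon x - mon y).
Proof.
move=> xy xw yw; have [x' nx rx] := NF_exists x; have [y' ny ry] := NF_exists y.
have e : x' = y'.
  apply: NF_unique => //; apply: cong_trans (reduces_cong ry).
  exact: cong_trans (cong_sym (reduces_cong rx)) xy.
have -> : mon x - mon y = (mon x - mon x') + - (mon y - mon y').
  by rewrite -e opprB addrA subrK.
by apply: trivial_modD; [|apply: trivial_modN]; apply: reduces_trivial.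
Qed.

Lemma binomial_groebner_shirshov : groebner_shirshov lt (@rel_polys k _ lt S).
Proof.
have cg u v a b : S u v \/ S v u -> cong S (a ++ u ++ b) (a ++ v ++ b).
  by case=> h; [apply: cong_rel|apply/cong_sym/cong_rel].
split=> [f|f g u v a b|f g u v a b].
- by move=> /rel_polys_elim [u [v [_ vu ->]]]; apply: gs_monic_binomial.
- move=> /rel_polys_elim [u1 [u2 [h1 l1 ->]]] /rel_polys_elim [v1 [v2 [h2 l2 ->]]].
  move=> /leading_inj /(_ (leading_binomial l1)) -> /leading_inj /(_ (leading_binomial l2)) -> e _.
  (* The leading words cancel; what remains is the difference of the two words obtained from the
     overlap by one step each. *)
  rewrite mulrBl mulrBr !mon_cat -e opprB addrC addrA subrK.
  have := cg _ _ [::] b h1; have := cg _ _ a [::] h2; rewrite !cats0 /= -e => c2 c1.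
  apply: cong_trivial.
  + exact: cong_trans (cong_sym c2) c1.
  + by have := lt_cat a [::] l2; rewrite !cats0 -e.
  + exact: (lt_cat [::] b l1).
- move=> /rel_polys_elim [u1 [u2 [h1 l1 ->]]] /rel_polys_elim [v1 [v2 [h2 l2 ->]]].
  move=> /leading_inj /(_ (leading_binomial l1)) -> /leading_inj /(_ (leading_binomial l2)) -> e.
  rewrite mulrBr mulrBl !mon_cat -!catA -e opprB addrC addrA subrK.
  have := cg _ _ a b h2; rewrite -e => c2.
  have := cg _ _ [::] [::] h1; rewrite /= !cats0 => c1.
  apply: cong_trivial => //.
  + exact: cong_trans (cong_sym c2) c1.
  + by rewrite e; apply: lt_cat.
Qed.

End ConfluentSystem.

Lemma ideal_of0 (S : set A) : ideal_of S 0.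
Proof.
by exists 0%N, (fun=> 0), (fun=> 0), (fun=> 0); split=> [[]|] //; rewrite big_ord0.
Qed.

Lemma ideal_ofD (S : set A) f g : ideal_of S f -> ideal_of S g -> ideal_of S (f + g).
Proof.
move=> [m1 [a1 [b1 [s1 [h1 ->]]]]] [m2 [a2 [b2 [s2 [h2 ->]]]]].
pose gl T (p : 'I_m1 -> T) (q : 'I_m2 -> T) (i : 'I_(m1 + m2)) :=
  match split i with inl j => p j | inr j => q j end.
have glL T (p : 'I_m1 -> T) q i : gl T p q (lshift m2 i) = p i.
  by rewrite /gl (unsplitK (inl i)).
have glR T p (q : 'I_m2 -> T) i : gl T p q (rshift m1 i) = q i.
  by rewrite /gl (unsplitK (inr i)).
exists (m1 + m2)%N, (gl _ a1 a2), (gl _ b1 b2), (gl _ s1 s2); split.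
- by move=> i; rewrite /gl; case: (split i).
- by apply: sum_split => i; rewrite ?glL ?glR.
Qed.

Lemma ideal_ofM (S : set A) f g h : ideal_of S h -> ideal_of S (f * h * g).
Proof.
move=> [m [a [b [s [hs ->]]]]].
exists m, (fun i => f * a i), (fun i => b i * g), s; split=> //.
by rewrite mulr_sumr mulr_suml; apply: eq_bigr => i _; rewrite !mulrA.
Qed.

Lemma ideal_of_id (S : set A) f : S f -> ideal_of S f.
Proof.
move=> hf; exists 1%N, (fun=> 1), (fun=> 1), (fun=> f); split=> //.
by rewrite big_ord1 mul1r mulr1.
Qed.

Lemma ideal_ofN (S : set A) f : ideal_of S f -> ideal_of S (- f).
Proof. by move=> /(ideal_ofM (-1) 1); rewrite mulN1r mulr1. Qed.

Lemma cong_ideal R u v : cong R u v -> ideal_of (rel_polys lt R) (mon u - mon v).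
Proof.
elim=> [x|x y _ h|x y z _ h1 _ h2|a x y b h].
- by rewrite subrr; apply: ideal_of0.
- by rewrite -opprB; apply: ideal_ofN.
- by rewrite -(subrK (mon y) (mon x)) -addrA; apply: ideal_ofD.
- have -> : mon (a ++ x ++ b) - mon (a ++ y ++ b) = mon a * (mon x - mon y) * mon b.
    by rewrite mulrBr mulrBl !mon_cat !catA.
  apply: ideal_ofM; have [->|/lt_total /orP[l|l]] := eqVneq x y.
  + by rewrite subrr; apply: ideal_of0.
  + by rewrite -opprB; apply/ideal_ofN/ideal_of_id/rel_polys_intro => //; right.
  + by apply/ideal_of_id/rel_polys_intro => //; left.
Qed.

Lemma ideal_of_sub R S : (forall u v, R u v -> cong S u v) ->
  (ideal_of (@rel_polys k _ lt R) `<=` ideal_of (@rel_polys k _ lt S))%classic.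
Proof.
move=> sub h [m [a [b [s [hs ->]]]]].
elim/big_ind: _ => [|f g|i _]; [exact: ideal_of0|exact: ideal_ofD|].
apply: ideal_ofM; have [u [v [huv _ ->]]] := rel_polys_elim (hs i).
by apply: cong_ideal; case: huv => /sub // /cong_sym.
Qed.

End BinomialGroebner.

(** * Rewriting and the braid group *)

Section LetterOrder.
Variable n : nat.
Hypothesis n_gt0 : 0 < n.

Lemma ord_lt_total (i j : 'I_n) : i != j -> (i < j) || (j < i).
Proof. by rewrite -neq_ltn. Qed.

Lemma letter_lt_irr : irreflexive (@letter_lt n).
Proof.
case=> //= x; rewrite /X1_lt ltnn lexlt_irr ?andbF // => i; exact: ltnn.
Qed.

Lemma letter_lt_trans : transitive (@letter_lt n).
Proof.
move=> [y|] [x|] [z|] //=; rewrite /X1_lt.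
move=> /orP[xy|/andP[/eqP xy lxy]] /orP[yz|/andP[/eqP yz lyz]].
- by rewrite (ltn_trans yz xy).
- by rewrite -yz xy.
- by rewrite xy yz.
- rewrite xy yz eqxx (lexlt_trans _ lxy lyz) ?orbT // => i j k; exact: ltn_trans.
Qed.

Lemma letter_lt_total (l m : letter n) : l != m -> letter_lt l m || letter_lt m l.
Proof.
case: l m => [x|] [y|] //= xy; rewrite /X1_lt; case: ltngtP => //= _.
apply: lexlt_total; [by move=> i; exact: ltnn|exact: ord_lt_total|].
by apply: contraNneq xy => /(nf_inj n_gt0) /val_inj ->.
Qed.

End LetterOrder.

(** * Termination of the rewriting *)

Section Rewriting.
Variable n : nat.
Hypothesis n_gt0 : 0 < n.
Local Open Scope group_scope.
Local Notation G := (coxeterB n).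
Local Notation delta := (delta n).
Local Notation L := (letter n).
Local Notation lt := (deglex (@letter_lt n)).
Implicit Types (a b c : G) (l m : L) (u v w : seq L).

(** Lengths are at most [n^2], so [Delta^-1] outweighs all other letters and moving it to the left
    lowers [moment]. *)
Definition weight l : nat := if l is Some a then len (val a) else (n * n).+1.

Definition total u : nat := sumn [seq weight l | l <- u].

(* Strictly decreases along the rewriting steps used below, since these move
   weight to the left and never increase the length or the total weight. *)
Fixpoint moment u : nat := if u is l :: u' then total u' + moment u' else 0.

Lemma total_cat u v : total (u ++ v) = (total u + total v)%N.
Proof. by rewrite /total map_cat sumn_cat. Qed.

Lemma moment_cat u v : moment (u ++ v) = (moment u + moment v + size u * total v)%N.
Proof. by elim: u => [|l u IH] /=; rewrite ?addn0 // IH total_cat mulSn; lia. Qed.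

Lemma moment_context u v x y : (size v <= size u)%N -> (total v <= total u)%N ->
  (moment v < moment u)%N -> (moment (x ++ v ++ y) < moment (x ++ u ++ y))%N.
Proof.
move=> h1 h2 h3; rewrite !moment_cat !total_cat.
have := leq_mul h1 (leqnn (total y)); have := leq_mul (leqnn (size x)) h2.
rewrite !mulnDr; lia.
Qed.

(** [Delta^-1 Delta] is deleted by [gsB_5], and [Delta^-1] passes to the left by [gsB_3]. If [a]
    absorbs all of [b], then [gsB_1] merges them; otherwise [gsB_2] moves the absorbed prefix, and
    the word decreases because a longer element is a smaller letter. *)
Lemma nf_edge_step l m : ~~ nf_edge l m -> exists v,
  [/\ gsB_rel [:: l; m] v, lt v [:: l; m], total v <= total [:: l; m]
    & moment v < moment [:: l; m]].
Proof.
case: l m => [[a a1]|] [[b b1]|] //=; last first.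
- rewrite negbK => /eqP e; subst b; exists [::]; split=> //.
    by have := gsB_5 n false; rewrite /Delta /= rrE.
  by have := delta_neq1 n_gt0; rewrite -len_gt0 // /total /=; lia.
- move=> _; exists [:: None; Some (exist _ a a1)]; split=> //=.
  + by have := gsB_3 false a1; rewrite rrE.
  + by rewrite /total /= !addn0 addnC.
  + by rewrite /total /= !addn0 ltnS; apply: len_le_delta.
move=> c1; have [cb ac _] := absorbP n_gt0 a b.
move: c1 cb ac; set c := absorb a b => c1 cb ac.
have [e|d1] := eqVneq c b.
  rewrite e in ac; have ab1 := perp_neq1 n_gt0 ac a1.
  exists [:: Some (exist _ (a * b) ab1)]; split=> //.
  + by have := gsB_1 a1 b1 ac; rewrite !rrE.
  + by rewrite /total /= !addn0 ac.
  + by rewrite /total /= !addn0 len_gt0.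
have {}d1 : c^-1 * b != 1 by rewrite mulg_eq1 (inj_eq invg_inj).
have ac1 := perp_neq1 n_gt0 ac a1.
have cd := ple_perp cb.
exists [:: Some (exist _ (a * c) ac1); Some (exist _ (c^-1 * b) d1)]; split.
- have := gsB_2 a1 c1 d1 ac cd; rewrite mulVKg !rrE; exact.
- have lc : 0 < len c by rewrite len_gt0.
  by rewrite /deglex /= /X1_lt /= ac -addn1 leq_add2l lc.
- by rewrite /total /= !addn0 ac -addnA cb.
- have lc : 0 < len c by rewrite len_gt0.
  by move: cb; rewrite /= /total /= !addn0 /ple => cb; len_lia.
Qed.

Lemma unsorted_factor (T : Type) (e : rel T) (s : seq T) : ~~ sorted e s ->
  exists (x : seq T) (l m : T) (y : seq T),
    s = x ++ [:: l; m] ++ y /\ ~~ e l m.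
Proof.
elim: s => // l [|m s] IH //=; rewrite negb_and => /orP[h|/IH [x [l' [m' [y [-> h]]]]]].
  by exists [::], l, m, s.
by exists (l :: x), l', m', y.
Qed.

Lemma gsB_normal_form u :
  exists2 v, sorted (@nf_edge n) v & reduces lt (@gsB_rel n) u v.
Proof.
elim: {u}(moment u).+1 {-2}u (ltnSn (moment u)) => // k IH u hu.
have [su|/unsorted_factor [x [l [m [y [e h]]]]]] := boolP (sorted (@nf_edge n) u).
  by exists u => //; apply: reduces_refl.
rewrite e in hu *.
have [v [hv lv tv mv]] := nf_edge_step h.
have [|z nz rz] := IH (x ++ v ++ y).
  rewrite -ltnS; apply: leq_trans hu; rewrite ltnS; apply: moment_context => //.
  by move: lv; rewrite /deglex => /orP[/ltnW//|/andP[/eqP->]].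
by exists z => //; apply: reduces_step rz => //; left.
Qed.


End Rewriting.

(** * The presentation of the braid group *)

Section Presentation.
Variable n : nat.
Hypothesis n_gt0 : 0 < n.
Local Open Scope group_scope.
Local Notation G := (coxeterB n).
Local Notation s := (@gen_s n).
Local Notation delta := (delta n).
Local Notation L := (letter n).
Local Notation congB := (cong (@braidB_rel n)).
Local Notation prod := (word_prod s).
Local Notation pos w := [seq (x, true) | x <- w].
Implicit Types (i : 'I_n) (a b c : G) (l m : L) (u v w : seq L).

Lemma congB_mul a b : perp a b -> congB (rr a ++ rr b) (rr (a * b)).
Proof.
move=> ab; have [->|a1] := eqVneq a 1; first by rewrite rr1 mul1g; apply: cong_refl.
have [->|b1] := eqVneq b 1; first by rewrite rr1 mulg1 cats0; apply: cong_refl.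
by have := cong_rel [::] [::] (braidB_mul a1 b1 ab); rewrite /= !cats0.
Qed.

Lemma congB_ple a b : ple a b -> congB (rr b) (rr a ++ rr (a^-1 * b)).
Proof. by move=> /ple_perp /congB_mul; rewrite mulVKg => /cong_sym. Qed.

Lemma congB_DeltaV e : congB (Delta n e ++ Delta n (~~ e)) [::].
Proof. by have := cong_rel [::] [::] (braidB_Delta n e); rewrite !cats0. Qed.

Lemma congB_Delta_comm a e : congB (rr a ++ Delta n e) (Delta n e ++ rr a).
Proof.
have ct : congB (rr a ++ Delta n true) (Delta n true ++ rr a).
  have e1 : (a^-1 * delta) * a = delta by rewrite -mulgA delta_central // mulKg.
  have p1 : perp (a^-1 * delta) a by rewrite /perp e1 (ple_delta n_gt0 a) addnC.
  have h : congB (rr delta) (rr (a^-1 * delta) ++ rr a).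
    by have := cong_sym (congB_mul p1); rewrite e1.
  apply: cong_trans (cong_catl _ h) _; rewrite catA; apply: cong_catr.
  exact/cong_sym/congB_ple/ple_delta.
case: e => //.
(* Inserting [Delta^-1 Delta] on the left reduces the commutation with [Delta^-1] to that with
   [Delta]. *)
have h1 : congB (rr a ++ Delta n false) (Delta n false ++ Delta n true ++ rr a ++ Delta n false).
  by rewrite [X in cong _ _ X]catA; apply/cong_sym/(cong_catr _ (congB_DeltaV false)).
apply: cong_trans h1 _; apply: cong_catl.
rewrite catA; apply: cong_trans (cong_catr _ (cong_sym ct)) _.
by rewrite -catA -[X in cong _ _ X]cats0; apply/cong_catl/(congB_DeltaV true).
Qed.

Lemma rr_inj a b : rr a = rr b -> a = b.
Proof.
have [->|a1] := eqVneq a 1; have [->|b1] := eqVneq b 1; rewrite ?rr1 ?rrE //.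
by case.
Qed.

Lemma gsB_cong u v : gsB_rel u v -> congB u v.
Proof.
case=> [a b a1 b1 ab|a b c a1 b1 c1 ab bc|a e a1|a b c m ab bc cm|e].
- exact: congB_mul.
- apply: cong_trans (cong_catl _ (cong_sym (congB_mul bc))) _.
  by rewrite catA; apply/cong_catr/congB_mul.
- exact: congB_Delta_comm.
- move=> /rr_inj bcE _.
  (* Both letters are split, the two middle factors merge into [Delta], and [Delta] passes to the
     left of [rr a]. *)
  apply: cong_trans (cong_cat (cong_sym (congB_mul ab)) (cong_sym (congB_mul cm))) _.
  rewrite -catA [rr b ++ _]catA.
  apply: cong_trans (cong_catl _ (cong_catr _ (congB_mul bc))) _.
  rewrite bcE catA [X in cong _ _ X]catA; apply/cong_catr/(congB_Delta_comm _ true).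
- exact: congB_DeltaV.
Qed.

Lemma braidB_gsB u v : braidB_rel u v -> gsB_rel u v.
Proof. by case=> [e|a b a1 b1 ab]; [apply: gsB_5|apply: gsB_1]. Qed.

Local Notation F a := (word_prod (@sigma n) (nf a)).
Local Notation fw := (word_prod (@letter_braid n)).

Lemma cong_artin_sigma (u v : seq 'I_n) : cong (@artinB_rel n) u v ->
  word_prod (@sigma n) u = word_prod (@sigma n) v.
Proof. exact: cong_word_prod. Qed.

(** Under [perp] the concatenation of the two normal words is reduced, so Matsumoto's theorem makes
    it congruent to the normal word of the product. *)
Lemma lift_mul a b : perp a b -> F a * F b = F (a * b).
Proof.
move=> ab; rewrite -word_prod_cat; apply: cong_artin_sigma.
have e : prod (nf a ++ nf b) = a * b by rewrite word_prod_cat !prod_nf.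
by rewrite -e; apply/cong_sym/nf_artin => //; apply/reduced_len => //; rewrite e ab size_cat.
Qed.

Lemma lift1 : F (1 : G) = 1.
Proof. by rewrite (size0nil (len1 n_gt0)) word_prod_nil. Qed.

Lemma fw_rr a : fw (rr a) = F a.
Proof.
by have [->|a1] := eqVneq a 1; rewrite ?rr1 ?lift1 ?word_prod_nil // rrE word_prod1.
Qed.

Lemma fw_Delta_inv : fw (Delta n false) = (F delta)^-1.
Proof. exact: word_prod1. Qed.

Lemma congB_fw u v : congB u v -> fw u = fw v.
Proof.
elim=> [//|x y _ ->//|x y z _ -> _ ->//|x y z t h].
rewrite !word_prod_cat; congr (_ * (_ * _)).
case: h => [e|a b a1 b1 ab]; last by rewrite word_prod_cat !fw_rr lift_mul.
rewrite word_prod_cat word_prod_nil.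
by case: e; rewrite fw_Delta_inv /= fw_rr ?mulgV ?mulVg.
Qed.

(** Since [(s_i delta) s_i = delta] with lengths adding, the inverse of [sigma i] is
    [Delta^-1 r(s_i delta)]. *)
Definition unlift_letter (x : 'I_n * bool) : seq L :=
  if x.2 then rr (s x.1) else Delta n false ++ rr (s x.1 * delta).

Definition unlift (x : seq ('I_n * bool)) : seq L := flatten (map unlift_letter x).

Lemma unlift_cat x y : unlift (x ++ y) = unlift x ++ unlift y.
Proof. by rewrite /unlift map_cat flatten_cat. Qed.

Lemma gen_delta_perp i : perp (s i * delta) (s i) /\ (s i * delta) * s i = delta.
Proof.
have e : (s i * delta) * s i = delta by rewrite -delta_central // -mulgA gen_sK mulg1.
split=> //; rewrite /perp e; have := len_mul_delta n_gt0 (s i).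
by rewrite len_gen // len_delta.
Qed.

Lemma unlift_reduced (w : seq 'I_n) : reduced w -> congB (unlift (pos w)) (rr (prod w)).
Proof.
elim: w => [|i w IH] rw; first by rewrite word_prod_nil rr1; apply: cong_refl.
have rw' := reduced_tail rw.
apply: cong_trans (cong_catl (rr (s i)) (IH rw')) _.
rewrite word_prod_cons; apply: congB_mul.
move: rw rw'; rewrite !(reduced_len n_gt0) /perp word_prod_cons len_gen // => -> ->.
by rewrite add1n.
Qed.

Lemma unlift_cong x y :
  cong (group_rel (@artinB_rel n)) x y -> congB (unlift x) (unlift y).
Proof.
elim=> [u|u v _ h|u v w _ h1 _ h2|u v w t h].
- exact: cong_refl.
- exact: cong_sym.
- exact: cong_trans h1 h2.
rewrite !unlift_cat; apply/cong_catl/cong_catr; case: h => [{}v {}w h|i e].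
  have [rv rw] := artin_reduced n_gt0 h.
  apply: cong_trans (unlift_reduced rv) _; apply: cong_sym.
  have -> : prod v = prod w; last exact: unlift_reduced.
  apply: cong_artin_prod; rewrite -[v]cats0 -[w]cats0; exact: (cong_rel [::]).
have [p1 e1] := gen_delta_perp i.
have h1 : congB (Delta n false ++ rr (s i * delta) ++ rr (s i)) [::].
  apply: cong_trans (cong_catl _ (congB_mul p1)) _; rewrite e1.
  exact: (congB_DeltaV false).
case: e; rewrite /unlift /unlift_letter /= cats0; last first.
  exact: h1.
(* For a generator followed by its inverse, [Delta^-1] is moved to the front and the factorization
   [delta = s_i (s_i delta)] is used instead. *)
rewrite -[_ :: _]/(Delta n false ++ _) catA.
apply: cong_trans (cong_catr _ (congB_Delta_comm _ false)) _; rewrite -catA.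
have e2 : rr delta = rr (s i * (s i * delta)) by rewrite mulgA gen_sK mul1g.
apply: cong_trans (congB_DeltaV false); apply: cong_catl; rewrite /Delta /= e2.
apply: congB_mul; rewrite /perp mulgA gen_sK mul1g.
by have := ple_delta n_gt0 (s i); rewrite /ple gen_sV.
Qed.

Definition lift_word l : seq ('I_n * bool) :=
  if l is Some a then pos (nf (val a)) else word_inv (pos (nf delta)).

Lemma letter_braidE l : letter_braid l = pg_class (@artinB_rel n) (lift_word l).
Proof.
case: l => [a|] /=; first exact: word_prod_gen.
rewrite word_prod_gen; apply: mulg1_eq.
apply: etrans (esym (pg_class_cat _ _ _)) _.
exact/pg_classP/word_mulV.
Qed.

Lemma fwE u : fw u = pg_class (@artinB_rel n) (flatten (map lift_word u)).
Proof.
elim: u => [|l u IH]; first exact: word_prod_nil.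
by rewrite word_prod_cons IH letter_braidE /= [RHS]pg_class_cat.
Qed.

Lemma unlift_lift l : congB (unlift (lift_word l)) [:: l].
Proof.
case: l => [[a a1]|] /=.
  apply: cong_trans (unlift_reduced (reduced_nf n_gt0 a)) _.
  by rewrite prod_nf // rrE; apply: cong_refl.
have h1 := unlift_reduced (reduced_nf n_gt0 delta); rewrite prod_nf // in h1.
set y := unlift (word_inv _).
have h2 : congB (rr delta ++ y) [::].
  apply: cong_trans (cong_catr _ (cong_sym h1)) _; rewrite -unlift_cat.
  exact: (unlift_cong (word_mulV (@artinB_rel n) (pos (nf delta)))).
(* Up to congruence [y] is a right inverse of [Delta], so putting [Delta^-1 Delta] in front of it
   identifies it with [Delta^-1]. *)
apply: cong_trans (cong_sym (cong_catr y (congB_DeltaV false))) _.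
by rewrite -catA; apply: cong_catl h2.
Qed.

(** [unlift] inverts the evaluation: it undoes [lift_word] up to congruence, which makes the
    evaluation faithful, and evaluating [unlift] of a representative of [g] returns [g]. *)
Lemma braidB_presentation : monoid_presentation (@braidB_rel n) (@letter_braid n).
Proof.
split=> [g|u v]; last first.
  split; first exact: congB_fw.
  rewrite !fwE => /pg_classP /unlift_cong h.
  have e w : congB (unlift (flatten (map lift_word w))) w.
    elim: w => [|l w IH] /=; first exact: cong_refl.
    by rewrite unlift_cat; apply: (cong_cat (unlift_lift l) IH).
  exact: cong_trans (cong_sym (e u)) (cong_trans h (e v)).
exists (unlift (repr g)); rewrite -[RHS]pg_classK.
elim: (repr g) => [|[i e] w IH]; first exact: word_prod_nil.
rewrite -cat1s unlift_cat word_prod_cat IH [RHS]pg_class_cat; congr (_ * _).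
have sE : F (s i) = sigma i.
  rewrite -[RHS](word_prod1 (@sigma n)); apply: cong_artin_sigma.
  rewrite -[s i](word_prod1 s); apply: nf_artin => //; apply/(reduced_len n_gt0).
  by rewrite word_prod1 len_gen.
rewrite /unlift /= cats0 /unlift_letter /=; case: e; first by rewrite fw_rr.
have [p1 e1] := gen_delta_perp i.
rewrite -[None :: _]/(Delta n false ++ _) word_prod_cat fw_Delta_inv fw_rr.
by rewrite -{1}e1 -lift_mul // invgM mulgVK pg_class_inv sE.
Qed.

End Presentation.

Theorem theorem3p6 (n : nat) (hn : (2 <= n)%N) (k : fieldType) :
  monoid_presentation (@braidB_rel n) (@letter_braid n) /\
  gs_basis_of_monoid k (deglex (@letter_lt n)) (@braidB_rel n) (@gsB_rel n).
Proof.
have n_gt0 : (0 < n)%N by apply: leq_trans hn.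
have li := @letter_lt_irr n; have lt := @letter_lt_trans n.
have ltot := letter_lt_total n_gt0.
split; first exact: braidB_presentation.
split.
  apply: (@binomial_groebner_shirshov _ _ _ _ _ _ _ _ (fun u => sorted (@nf_edge n) u)).
  - exact: deglex_irr.
  - exact: deglex_trans.
  - exact: deglex_total.
  - by move=> a u v b; apply: deglex_cat.
  - exact: gsB_normal_form.
  - move=> u v su sv h; apply: (sorted_cong_eq n_gt0 su sv).
    by apply: cong_sub h => a b; apply: gsB_cong.
(* The ideals agree because each system of relations lies in the congruence generated by the
   other. *)
rewrite eqEsubset; split; apply: ideal_of_sub.
all: try exact: deglex_irr.
all: try exact: deglex_trans.
all: try exact: deglex_total.
all: try by move=> a u v b; apply: deglex_cat.
- by move=> u v; apply: gsB_cong.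
- move=> u v /braidB_gsB h.
  by have := cong_rel [::] [::] h; rewrite !cats0.
Qed.
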